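(* Let $\mu\in\mathbb R$ and $\mathcal H^N=-2(\epsilon-\mu)S^N_z-\frac{2T_c}{N}S^N_+S^N_-$, and for $t\in\mathbb R$ let $\mathcal U^N(t)=e^{-it(\mathcal H^N\otimes\mathbb I-\mathbb I\otimes\mathcal H^N)}$. Then for every $t\in\mathbb R$, $\mathcal U^N(t)$ converges in the mesoscopic limit to $\mathcal U(t)=e^{-it\,2\mu\hat p_\varphi}$, i.e. for all non-negative integers $n,n',m,m'$, $$\lim_{N\to\infty}\big\langle (E^N_-)^n(E^N_+)^{n'}\,\mathcal U^N(t)\,(E^N_+)^m(E^N_-)^{m'}\big\rangle^N_\beta=\Omega\big(e^{-i(n-n')\hat\varphi}\,e^{-2it\mu\hat p_\varphi}\,e^{i(m-m')\hat\varphi}\big).$$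
   Context: Fix real $\epsilon$, $T_c>0$, $\beta>0$. For $N\in\mathbb N$, on $(\mathbb C^2)^{\otimes N}$ let $\sigma^{(k)}_i$ be the Pauli matrices at site $k$, $S^N_i=\frac12\sum_{k=1}^N\sigma^{(k)}_i$ ($i=x,y,z$), $S^N_\pm=S^N_x\pm iS^N_y$, $H^N=-2\epsilon S^N_z-\frac{2T_c}{N}S^N_+S^N_-$, $\rho^N_\beta=e^{-\beta H^N}/\mathrm{Tr}\,e^{-\beta H^N}$. With $\{|e_a\rangle\}$ an orthonormal eigenbasis of $H^N$ of joint eigenvectors of $(\vec S^N)^2,S^N_z$ and $\rho^N_\beta=\sum_ar_a|e_a\rangle\langle e_a|$, let $|\Omega^N_\beta\rangle=\sum_a\sqrt{r_a}|e_a\rangle\otimes|e_a\rangle$ and $\langle X\rangle^N_\beta=\langle\Omega^N_\beta|X|\Omega^N_\beta\rangle$. Let $\mathfrak c=\lim_N(N^{-2}\mathrm{Tr}[\rho^N_\beta S^N_+S^N_-])^{1/2}$, assumed $>0$; $E^N_\pm=\frac{1}{\mathfrak cN}S^N_\pm\otimes\mathbb I$. On $L^2([0,2\pi])$: $\hat p_\varphi=-i\,d/d\theta$ (periodic), $e^{in\hat\varphi}$ = multiplication by $e^{in\theta}$ ($n\in\mathbb Z$), $|0\rangle$ the constant $1/\sqrt{2\pi}$, $\Omega(X)=\langle0|X|0\rangle$. *)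

(* Defs.v *)
From mathcomp Require Import all_boot all_order all_algebra.
From mathcomp Require Import complex.
From mathcomp Require Import all_classical all_reals all_analysis.
Set Implicit Arguments. Unset Strict Implicit. Unset Printing Implicit Defensive.
Import Order.TTheory GRing.Theory Num.Theory.
Local Open Scope ring_scope.
Local Open Scope classical_set_scope.
Import numFieldNormedType.Exports.

Section Defs.
Variable R : realType.
Local Notation C := R[i].

Definition iC : C := Complex 0 1.
Definition rC (x : R) : C := Complex x 0.
Definition reC (z : C) : R := @complex.Re R z.
Definition imC (z : C) : R := @complex.Im R z.

Definition cvgC (u : nat -> C) (w : C) : Prop :=
  ((fun N => reC (u N)) @ \oo --> reC w) /\ ((fun N => imC (u N)) @ \oo --> imC w).

Definition mxOf (I : finType) (f : I -> I -> C) : 'M[C]_#|I| :=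
  \matrix_(i, j) f (enum_val i) (enum_val j).

Definition adj m n (A : 'M[C]_(m, n)) : 'M[C]_(n, m) := (map_mx (@Num.conj _) A)^T.

Definition pairT (I : finType) : finType := (I * I)%type.

Definition tens (I : finType) (A B : 'M[C]_#|I|) : 'M[C]_#|pairT I| :=
  mxOf (fun p q : pairT I =>
    A (enum_rank p.1) (enum_rank q.1) * B (enum_rank p.2) (enum_rank q.2)).
Definition tensv (I : finType) (u v : 'cV[C]_#|I|) : 'cV[C]_#|pairT I| :=
  \col_i (u (enum_rank (enum_val i).1) 0 * v (enum_rank (enum_val i).2) 0).

Definition expm n (A : 'M[C]_n) : 'M[C]_n :=
  let ps := fun K => \sum_(k < K) (rC (k`!%:R)^-1) *: A ^+ k in
  \matrix_(i, j) Complex (limn (fun K => reC (ps K i j)))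
                         (limn (fun K => imC (ps K i j))).

(* basis of (C^2)^{\otimes N}: spin configurations, true = spin up *)
Definition cfg (N : nat) := {ffun 'I_N -> bool}.
Definition Op (N : nat) := 'M[C]_#|cfg N|.

(* Pauli matrices in the basis (up, down) *)
Definition pauli_x (a b : bool) : C := if a != b then 1 else 0.
Definition pauli_y (a b : bool) : C :=
  if a == b then 0 else if a then - iC else iC.
Definition pauli_z (a b : bool) : C :=
  if a == b then (if a then 1 else -1) else 0.

(* sigma at site k: I \otimes ... \otimes sigma \otimes ... \otimes I *)
Definition sigma_at (N : nat) (p : bool -> bool -> C) (k : 'I_N) : Op N :=
  mxOf (fun s s' : cfg N =>
    p (s k) (s' k) * (if [forall j, (j != k) ==> (s j == s' j)] then 1 else 0)).

Definition Stot (N : nat) (p : bool -> bool -> C) : Op N :=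
  (rC (2^-1)) *: \sum_(k < N) sigma_at p k.
Definition Sx N := Stot N pauli_x.
Definition Sy N := Stot N pauli_y.
Definition Sz N := Stot N pauli_z.
Definition Splus N : Op N := Sx N + iC *: Sy N.
Definition Sminus N : Op N := Sx N - iC *: Sy N.
Definition S2 N : Op N := Sx N *m Sx N + Sy N *m Sy N + Sz N *m Sz N.

Definition Ham (eps Tc : R) (N : nat) : Op N :=
  - (rC (2 * eps)) *: Sz N - (rC (2 * Tc / N%:R)) *: (Splus N *m Sminus N).

Definition rho (eps Tc beta : R) (N : nat) : Op N :=
  let G := expm (rC (- beta) *: Ham eps Tc N) in (\tr G)^-1 *: G.

Definition good_basis (eps Tc : R) (N : nat) (e : 'I_#|cfg N| -> 'cV[C]_#|cfg N|) :=
  (forall a b, adj (e a) *m e b = (a == b)%:R%:M) /\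
  (forall a, exists l1 l2 l3 : C,
     [/\ Ham eps Tc N *m e a = l1 *: e a,
         S2 N *m e a = l2 *: e a &
         Sz N *m e a = l3 *: e a]).

(* eigenvalue r_a of rho in the basis e *)
Definition rcoef (eps Tc beta : R) N (e : 'I_#|cfg N| -> 'cV[C]_#|cfg N|) a : C :=
  (adj (e a) *m rho eps Tc beta N *m e a) 0 0.

(* purification |Omega^N_beta> = sum_a sqrt(r_a) e_a \otimes e_a *)
Definition OmegaN (eps Tc beta : R) N (e : 'I_#|cfg N| -> 'cV[C]_#|cfg N|) :
  'cV[C]_#|pairT (cfg N)| :=
  \sum_a sqrtC (rcoef eps Tc beta e a) *: tensv (e a) (e a).

Definition expect (eps Tc beta : R) N (e : 'I_#|cfg N| -> 'cV[C]_#|cfg N|)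
  (X : 'M[C]_#|pairT (cfg N)|) : C :=
  (adj (OmegaN eps Tc beta e) *m X *m OmegaN eps Tc beta e) 0 0.

Definition Eplus (c : R) N := rC ((c * N%:R)^-1) *: tens (Splus N) 1.
Definition Eminus (c : R) N := rC ((c * N%:R)^-1) *: tens (Sminus N) 1.

Definition UN (eps mu Tc t : R) N : 'M[C]_#|pairT (cfg N)| :=
  let cH := Ham (eps - mu) Tc N in
  expm ((- iC * rC t) *: (tens cH 1 - tens 1 cH)).

(* elements represented by 2pi-periodic functions R -> C *)
Definition expi (x : R) : C := Complex (cos x) (sin x).
Definition mulE (k : int) (f : R -> C) : R -> C := fun th => expi (k%:~R * th) * f th.
(* e^{-i s p_phi}, p_phi = -i d/dtheta periodic: translation by s *)
Definition transl (s : R) (f : R -> C) : R -> C := fun th => f (th - s).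
Definition vac : R -> C := fun _ => rC (Num.sqrt (2 * pi))^-1.
Definition cint02pi (f : R -> C) : C :=
  Complex (Rintegral lebesgue_measure `[0, 2 * pi] (fun x => reC (f x)))
          (Rintegral lebesgue_measure `[0, 2 * pi] (fun x => imC (f x))).
Definition OmegaL (X : (R -> C) -> (R -> C)) : C :=
  cint02pi (fun th => Num.conj (vac th) * X vac th).

End Defs.

(* Main.v *)
Require Import Defs.
From mathcomp Require Import all_boot all_order all_algebra.
From mathcomp Require Import complex.
From mathcomp Require Import all_classical all_reals all_analysis.
From mathcomp Require Import ring lra zify.
Import Order.TTheory GRing.Theory Num.Theory.
Import numFieldNormedType.Exports.
Set Implicit Arguments.
Unset Strict Implicit.
Unset Printing Implicit Defensive.
Local Open Scope ring_scope.

(** On a joint eigenvector of S^2 = J(J+1) and S_z = M, both H and the coupled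
    Hamiltonian are scalars, so the matrix element is the Gibbs average of a
    phase times a product of factors (J^2 - M^2)/N^2 + O(1/N), and it vanishes
    unless n - n' = m - m'. The phase advances by
    2 mu (m - m') + 4 Tc (m - m') (M/N - eps/(2Tc)) + O(1/N), so everything
    reduces to M/N -> eps/(2Tc) and (J^2 - M^2)/N^2 -> c^2 in L^2 of the Gibbs
    distribution of (J, M).

    No large-deviation asymptotics are needed. With b = 4 beta Tc and
    m0 = eps/(2Tc), the weight of (J, M) changes by exp(b (m0 - M/N)) under
    M -> M+1 and by about (1-y)/(1+y) exp(b y/2), y = 2J/N, under J -> J+1.
    Shift identities, in which the factor J^2 - M^2 kills the boundary terms,
    force M/N = m0 and y = y1 wherever J^2 - M^2 is not small, y1 being the
    root of (1-y) exp(b y/2) = 1+y. Drift inequalities show that the region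
    y < y1 and the region |M|/N > |m0| have vanishing probability, which
    excludes a coexisting phase with J^2 - M^2 = o(N^2). *)

(** * Elementary estimates *)

Section RealAnalysis.
Variable R : realType.
Implicit Types x y z b : R.

(** The given eigenbasis is arbitrary inside degenerate joint eigenspaces, so its vectors need not
    line up into multiplets, and the eigenvalues of S^2 are not known beforehand to be J(J+1).
    Spectrum and multiplicities are both extracted from the squared matrix elements of S_- in that
    basis, whose row and column sums are scalars; afterwards the basis disappears from all sums. A
    second obstacle is that the equation for y1 changes character at b = 4. The distinction is
    confined to the construction of y1: [gap_sep] holds with y1 = 0 when b <= 4, and c > 0 later
    forces (y1/2)^2 - m0^2 > 0 and then identifies it with c^2. The margins in [gap_sep] are
    explicit polynomials, because a merely strict inequality would not turn a vanishing average into
    concentration. *)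

Lemma lipschitz1_of_derive (f df : R -> R) x y :
  (forall z, is_derive z 1 f (df z)) -> (forall z, `|df z| <= 1) ->
  `|f x - f y| <= `|x - y|.
Proof.
move=> fdf df1.
wlog xy : x y / x <= y.
  move=> H; case: (leP x y) => [|/ltW] /H //.
  by rewrite distrC [X in _ -> _ <= X]distrC.
have fc : {within `[x, y], continuous f}%classic.
  by apply: derivable_within_continuous => z _; apply: ex_derive.
have [c _] := MVT_segment xy (fun z _ => fdf z) fc.
rewrite distrC => ->; rewrite normrM [X in _ <= X]distrC.
by apply: ler_piMl.
Qed.

Lemma cos_lip x y : `|cos x - cos y| <= `|x - y|.
Proof.
apply: (@lipschitz1_of_derive _ (fun z => - sin z)) => z.
by rewrite normrN sin_max.
Qed.

Lemma sin_lip x y : `|sin x - sin y| <= `|x - y|.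
Proof. by apply: (@lipschitz1_of_derive _ cos) => z; rewrite cos_max. Qed.

Lemma expR_sub1_le x : expR x - 1 <= x * expR x.
Proof.
have := expR_ge1Dx (- x); rewrite expRN => h.
have e0 := expR_gt0 x.
have : (1 - x) * expR x <= 1 by rewrite -ler_pdivlMr // mul1r.
by rewrite mulrBl mul1r; lra.
Qed.

(** This is 2 artanh z minus the cubic term of its Taylor series. The remainder is still convex on
    [0, 1), and the removed cubic supplies the margins of [gap_sep]. *)
Definition cubic_artanh z : R := ln (1 + z) - ln (1 - z) - 2 / 3 * z ^+ 3.

Lemma is_derive_cubic_artanh x : -1 < x -> x < 1 ->
  is_derive x 1 cubic_artanh (2 / (1 - x ^+ 2) - 2 * x ^+ 2).
Proof.
move=> x0 x1.
have p1 : 0 < 1 + x by lra.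
have p2 : 0 < 1 - x by lra.
have d1 := is_derive1_ln p1.
have d2 := is_derive1_ln p2.
have a1 : is_derive x 1 (fun z : R => 1 + z) 1 by apply: is_derive_eq; lra.
have a2 : is_derive x 1 (fun z : R => 1 - z) (- 1) by apply: is_derive_eq; lra.
have i1 : is_derive x 1 (fun z : R => ln (1 + z)) ((1 + x)^-1 * 1).
  exact: (@is_derive1_comp R (@ln R) (fun z => 1 + z) x _ _ d1 a1).
have i2 : is_derive x 1 (fun z : R => ln (1 - z)) ((1 - x)^-1 * - 1).
  exact: (@is_derive1_comp R (@ln R) (fun z => 1 - z) x _ _ d2 a2).
rewrite /cubic_artanh; apply: is_derive_eq.
rewrite /GRing.scale /=; field.
by rewrite !gt_eqF //=; nra.
Qed.

(* [cubic_artanh] is convex on [0, 1) and vanishes at 0. *)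
Lemma cubic_artanh_star y z : 0 < y -> y < z -> z < 1 ->
  z * cubic_artanh y <= y * cubic_artanh z.
Proof.
move=> y0 yz z1.
pose D x := 2 / (1 - x ^+ 2) - 2 * x ^+ 2 : R.
have cont u v : 0 <= u -> v < 1 -> {within `[u, v], continuous cubic_artanh}%classic.
  move=> u0 v1; apply: derivable_within_continuous => x.
  rewrite in_itv /= => /andP[ux xv].
  by apply: ex_derive; apply: is_derive_cubic_artanh; lra.
have der u v x : 0 <= u -> v < 1 -> x \in `]u, v[ -> is_derive x 1 cubic_artanh (D x).
  rewrite in_itv /= => u0 v1 /andP[ux xv].
  by apply: is_derive_cubic_artanh; lra.
have y1 := lt_trans yz z1.
have [c1 c1y] := MVT_segment (ltW y0) (fun x => @der 0 y x (lexx _) y1) (cont _ _ (lexx _) y1).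
have [c2 c2y] := MVT_segment (ltW yz) (fun x => @der y z x (ltW y0) z1) (cont _ _ (ltW y0) z1).
move: c1y c2y; rewrite !in_itv /= => /andP[c10 c1y] /andP[yc2 c2z].
have -> : cubic_artanh 0 = 0 by rewrite /cubic_artanh addr0 subr0 subrr expr0n /= mulr0 subr0.
rewrite !subr0 => e2 e1.
have DD : D c1 <= D c2.
  have q1 : 0 < 1 - c1 ^+ 2 by nra.
  have q2 : 0 < 1 - c2 ^+ 2 by nra.
  have q12 : 1 - c2 ^+ 2 <= 1 - c1 ^+ 2 by nra.
  rewrite /D -subr_ge0.
  have -> : 2 / (1 - c2 ^+ 2) - 2 * c2 ^+ 2 - (2 / (1 - c1 ^+ 2) - 2 * c1 ^+ 2) =
    2 * (c2 ^+ 2 - c1 ^+ 2) * (((1 - c1 ^+ 2) * (1 - c2 ^+ 2))^-1 - 1).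
    by field; rewrite !gt_eqF.
  apply: mulr_ge0; first by lra.
  rewrite subr_ge0 invf_ge1; last exact: mulr_gt0.
  by rewrite mulr_ile1 //; [exact: ltW|exact: ltW|have := sqr_ge0 c1; lra|have := sqr_ge0 c2; lra].
have -> : cubic_artanh z = D c1 * y + D c2 * (z - y) by lra.
rewrite e1.
have : 0 <= y * (z - y) * (D c2 - D c1) by rewrite !mulr_ge0 //; lra.
by lra.
Qed.

(* Quantitative form of: [y1] is the largest solution in [0, 1) of
   (1 - y) exp(b y / 2) = 1 + y, which is positive iff [b > 4]. *)
Definition gap_sep b y1 :=
  [/\ 0 <= y1, y1 < 1,
   forall y, 0 < y -> y < y1 ->
     (1 + y) * (1 + 2 / 3 * y ^+ 2 * (y1 - y)) <= (1 - y) * expR (b * y / 2) &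
   forall y, y1 < y -> y <= 1 ->
     (1 - y) * expR (b * y / 2) <= (1 + y) * (1 - 3^-1 * y ^+ 2 * (y - y1))].

Lemma expR_neg_le x : 0 <= x -> x <= 1 -> expR (- x) <= 1 - x / 2.
Proof.
move=> x0 x1.
rewrite expRN -[X in _ <= X]invrK lef_pV2 ?posrE ?invr_gt0 ?expR_gt0 //; last by lra.
apply: le_trans (expR_ge1Dx x).
rewrite -div1r ler_pdivrMr; last by lra.
by nra.
Qed.

Lemma gap_eq_sep b : 0 < b -> exists y1, gap_sep b y1.
Proof.
move=> b0.
(* [psi] is the logarithm of (1 - y) exp(b y / 2) / (1 + y), so its sign tells which side of the
   equation is larger. *)
pose psi y := b * y / 2 - (ln (1 + y) - ln (1 - y)).
have psiE y : 0 <= y -> y < 1 -> (1 - y) * expR (b * y / 2) = (1 + y) * expR (psi y).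
  move=> y0 y1; rewrite /psi opprB expRD expRB !lnK ?posrE; [|lra|lra].
  by field; rewrite gt_eqF //; lra.
(* Below y1 the margin survives through exp(x) >= 1 + x; above y1 [expR_neg_le] loses a factor 2,
   hence 2/3 in one clause and 3^-1 in the other. The endpoint y = 1, where [psi] no longer
   represents the ratio, is separate. *)
have sep y1 : 0 <= y1 -> y1 < 1 ->
   (forall y, 0 < y -> y < y1 -> 2 / 3 * y * (y1 ^+ 2 - y ^+ 2) <= psi y) ->
   (forall y, y1 < y -> y < 1 -> psi y <= - (2 / 3 * y * (y ^+ 2 - y1 ^+ 2))) ->
   gap_sep b y1.
  move=> y10 y11 lo hi; split => // y.
    move=> y0 yy1; rewrite psiE; [|lra|lra].
    rewrite ler_pM2l; last lra.
    apply: le_trans (expR_ge1Dx _); rewrite lerD2l.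
    apply: le_trans (lo y y0 yy1).
    have : 0 <= 2 / 3 * y * y1 * (y1 - y) by rewrite !mulr_ge0 //; lra.
    by nra.
  move=> yy1; rewrite le_eqVlt => /predU1P[->|y_1].
    by rewrite subrr mul0r expr1n mulr_ge0 //; lra.
  have y0 : 0 < y by lra.
  rewrite psiE; [|lra|lra]; rewrite ler_pM2l; last lra.
  have ub : psi y <= - (2 / 3 * y ^+ 2 * (y - y1)).
    apply: le_trans (hi y yy1 y_1) _; rewrite lerN2.
    have : 0 <= 2 / 3 * y * y1 * (y - y1) by rewrite !mulr_ge0 //; lra.
    by nra.
  apply: (@le_trans _ _ (expR (- (2 / 3 * y ^+ 2 * (y - y1))))); first by rewrite ler_expR.
  have y2 : 0 <= y ^+ 2 <= 1 by rewrite sqr_ge0 /= expr_le1 //; lra.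
  apply: le_trans (expR_neg_le _ _) _.
  - by rewrite !mulr_ge0 //; lra.
  - have : y ^+ 2 * (y - y1) <= 1 * 1 by apply: ler_pM; lra.
    lra.
  - lra.
have psiB y : psi y = b * y / 2 - 2 / 3 * y ^+ 3 - cubic_artanh y.
  by rewrite /psi /cubic_artanh; lra.
have [b4|b4] := leP b 4.
  (* For b <= 4 the derivative of [cubic_artanh] is at least 2 while b y / 2 <= 2 y, so [psi] is
     negative on (0, 1). *)
  exists 0; apply: sep => // y y0 y1; first by lra.
  rewrite psiB.
  have : 2 * y <= cubic_artanh y.
    have cont v : v < 1 -> {within `[0, v], continuous cubic_artanh}%classic.
      move=> v1; apply: derivable_within_continuous => x.
      rewrite in_itv /= => /andP[ux xv].
      by apply: ex_derive; apply: is_derive_cubic_artanh; lra.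
    have der v x : v < 1 -> x \in `]0, v[ ->
        is_derive x 1 cubic_artanh (2 / (1 - x ^+ 2) - 2 * x ^+ 2).
      rewrite in_itv /= => v1 /andP[ux xv].
      by apply: is_derive_cubic_artanh; lra.
    have [c cy] := MVT_segment (ltW y0) (fun x => @der y x y1) (cont _ y1).
    move: cy; rewrite in_itv /= => /andP[c0 cy].
    have -> : cubic_artanh 0 = 0.
      by rewrite /cubic_artanh addr0 subr0 subrr expr0n /= mulr0 subr0.
    rewrite !subr0 => ->; rewrite ler_pM2r //.
    have q : 0 < 1 - c ^+ 2 by nra.
    rewrite lerBrDr ler_pdivlMr //.
    have := sqr_ge0 (c ^+ 2).
    by nra.
  have : b * y <= 4 * y by rewrite ler_pM2r.
  by rewrite expr0n /=; lra.
pose q y := (1 - y) * expR (b * y / 2) - (1 + y).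
(* With the exponential replaced by its lower bound, (1 - y)(1 + b y / 2) > 1 + y exactly for 0 < y
   < (b - 4) / b. Starting from the midpoint of that interval keeps the root away from the trivial
   one at 0. *)
pose y0 := (b - 4) / (2 * b).
have y00 : 0 < y0 by rewrite divr_gt0 //; lra.
have y01 : y0 < 1 by rewrite /y0 ltr_pdivrMr; lra.
have qy0 : 0 < q y0.
  have h : 1 + b * y0 / 2 <= expR (b * y0 / 2) by exact: expR_ge1Dx.
  have : (1 - y0) * (1 + b * y0 / 2) <= (1 - y0) * expR (b * y0 / 2).
    by rewrite ler_pM2l //; lra.
  rewrite /q.
  have : b * y0 = (b - 4) / 2 by rewrite /y0; field; rewrite gt_eqF.
  by nra.
have cq : {within `[y0, 1], continuous q}%classic.
  apply: derivable_within_continuous => x _.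
  by rewrite /q; apply: ex_derive.
have [|y1] := IVT (ltW y01) cq (v := 0).
  have -> : q 1 = - 2 by rewrite /q; lra.
  by rewrite ge_min le_max (ltW qy0); apply/andP; split; apply/orP; [right; lra|left].
rewrite in_itv /= => /andP[y0y1 y1le1] qy1.
have y11 : y1 < 1.
  rewrite lt_neqAle y1le1 andbT; apply/eqP => e.
  by move: qy1; rewrite e /q; lra.
have y1_0 : 0 < y1 by lra.
have ps1 : psi y1 = 0.
  have := psiE y1 (ltW y1_0) y11; move: qy1; rewrite /q => /eqP.
  rewrite subr_eq0 => /eqP -> h.
  have : expR (psi y1) = 1.
    apply: (@mulfI _ (1 + y1)); first by rewrite gt_eqF //; lra.
    by rewrite mulr1 -h.
  by move/eqP; rewrite -expR0 (inj_eq (@expR_inj R)) => /eqP.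
exists y1; apply: sep => //; first lra.
(* The value of [cubic_artanh] at y1 is known from [psi y1 = 0]; comparing along the chord from 0
   cancels the linear terms and leaves the cubic difference. *)
- move=> y yp yy1; have := cubic_artanh_star yp yy1 y11.
  move: ps1; rewrite !psiB => ps1 st.
  rewrite -(ler_pM2l y1_0).
  have e1 : cubic_artanh y1 = b * y1 / 2 - 2 / 3 * y1 ^+ 3 by lra.
  rewrite e1 in st.
  by nra.
- move=> y yy1 y_1; have := cubic_artanh_star y1_0 yy1 y_1.
  move: ps1; rewrite !psiB => ps1 st.
  rewrite -(ler_pM2l y1_0).
  have e1 : cubic_artanh y1 = b * y1 / 2 - 2 / 3 * y1 ^+ 3 by lra.
  rewrite e1 in st.
  by nra.
Qed.

End RealAnalysis.

(** * Gibbs weights on spin multiplets *)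

Section Sums.
Local Open Scope classical_set_scope.
Local Open Scope ring_scope.
Variable R : realType.

Lemma sum_shift n (u v : nat -> R) : u 0 = 0 -> v n = 0 ->
  (forall k, (k < n)%N -> u k.+1 = v k) ->
  \sum_(0 <= k < n.+1) u k = \sum_(0 <= k < n.+1) v k.
Proof.
move=> u0 vn uv; rewrite big_nat_recl // big_nat_recr //= u0 vn add0r addr0.
by apply: eq_big_nat => k /= kn; exact: uv.
Qed.

(* If the weights grow by a factor at least [1 + g] in the direction of
   decreasing index wherever [f > 0], then comparing [sum p f] with its shift
   bounds [sum p g f] by the increment of [f]. *)
Lemma drift n (p f g q : nat -> R) (A B h : R) :
  (forall k, 0 <= p k) -> p n.+1 = 0 ->
  f 0 = 0 -> (forall k, 0 <= f k) -> (forall k, f k.+1 <= f k + h) ->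
  0 <= h -> 0 <= A ->
  (forall k, p k.+1 != 0 -> 0 < f k -> (1 + g k) * p k.+1 <= p k) ->
  q 0 = 0 -> (forall k, p k.+1 != 0 -> q k.+1 <= A * (g k * f k) + B) -> 0 <= B ->
  \sum_(0 <= k < n.+1) p k * q k <= (A * h + B) * \sum_(0 <= k < n.+1) p k.
Proof.
move=> p0 pn f0 fpos fS h0 A0 pS q0 qS B0.
have tail : \sum_(0 <= k < n) p k.+1 <= \sum_(0 <= k < n.+1) p k.
  by rewrite [X in _ <= X]big_nat_recl // lerDr.
have S1 : \sum_(0 <= k < n.+1) (1 + g k) * f k * p k.+1 <= \sum_(0 <= k < n.+1) p k * f k.
  apply: ler_sum => k _.
  have [->|pk] := eqVneq (p k.+1) 0; first by rewrite mulr0 mulr_ge0.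
  have := fpos k; rewrite le_eqVlt => /predU1P[<-|fk]; first by rewrite !mulr0 mul0r.
  by rewrite mulrAC ler_pM2r // pS.
have S2 : \sum_(0 <= k < n) p k.+1 * (g k * f k) <= h * \sum_(0 <= k < n) p k.+1.
  have : \sum_(0 <= k < n) (1 + g k) * f k * p k.+1 <= \sum_(0 <= k < n) p k.+1 * (f k + h).
    move: S1; rewrite big_nat_recr //= pn mulr0 addr0 big_nat_recl // f0 mulr0 add0r => S1.
    by apply: le_trans S1 _; apply: ler_sum => k _; rewrite ler_wpM2l.
  rewrite -subr_ge0 -sumrB => H; rewrite -subr_ge0 mulr_sumr -sumrB; move: H.
  by congr (is_true (_ <= _)); apply: eq_bigr => k _; ring.
rewrite big_nat_recl // q0 mulr0 add0r.
apply: (@le_trans _ _ (\sum_(0 <= k < n) (A * (p k.+1 * (g k * f k)) + B * p k.+1))).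
  apply: ler_sum => k _; have [->|pk] := eqVneq (p k.+1) 0; first by rewrite !(mul0r,mulr0) addr0.
  apply: le_trans (ler_wpM2l (p0 _) (qS k pk)) _.
  by rewrite mulrDr [B * _]mulrC [A * (p _ * _)]mulrCA.
rewrite big_split /= -!mulr_sumr mulrDl; apply: lerD; last by rewrite ler_wpM2l.
rewrite -mulrA ler_wpM2l //; apply: le_trans S2 _; by rewrite ler_wpM2l.
Qed.
End Sums.

Section Gibbs.
Local Open Scope classical_set_scope.
Local Open Scope ring_scope.
Variable R : realType.
Implicit Types (N i k : nat).

(* The pair (i, k) stands for J = N/2 - i and M = k - N/2, so that [adm] says
   |M| <= J; the rescaled variables are ysc = 2J/N, msc = M/N and
   xsc = (J^2 - M^2)/N^2. [deg N i] is the multiplicity of spin J, that is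
   'C(N, i) - 'C(N, i - 1). *)
Definition adm N i k := (i <= k)%N && (i + k <= N)%N.
Definition ysc N i : R := 1 - 2 * i%:R / N%:R.
Definition msc N k : R := k%:R / N%:R - 2^-1.
Definition spinJ N i : R := N%:R / 2 - i%:R.
Definition spinM N k : R := k%:R - N%:R / 2.
Definition deg N i : R := 'C(N.+1, i)%:R * (N.+1%:R - 2 * i%:R) / N.+1%:R.
Definition xsc N i k : R := (ysc N i / 2) ^+ 2 - msc N k ^+ 2.

Variables b m0 : R.

(** With b = 4 beta Tc and m0 = eps / (2 Tc) this is -beta times the energy at S^2 = lam, S_z = M.
    The argument [lam] is free because the eigenvalue is identified as J(J+1) only after
    counting. *)
Definition logw N (lam M : R) : R := b * (m0 * M + (lam - M ^+ 2 + M) / (2 * N%:R)).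
(** The value 0 outside [adm] lets all sums range over one fixed square, so that either index can be
    shifted alone. *)
Definition wt N i k : R :=
  if adm N i k then deg N i * expR (logw N (spinJ N i * (spinJ N i + 1)) (spinM N k)) else 0.

Definition wsum N (G : nat -> nat -> R) : R :=
  \sum_(0 <= i < N.+1) \sum_(0 <= k < N.+1) wt N i k * G i k.
Definition av N (G : nat -> nat -> R) : R := wsum N G / wsum N (fun _ _ => 1).

Lemma deg_gt0 N i : (2 * i <= N)%N -> 0 < deg N i.
Proof.
move=> iN; rewrite /deg divr_gt0 // mulr_gt0 //.
  by rewrite ltr0n bin_gt0; lia.
by rewrite -natrM subr_gt0 ltr_nat; lia.
Qed.

Lemma adm_half N i k : adm N i k -> (2 * i <= N)%N.
Proof. by rewrite /adm; lia. Qed.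

Lemma wt_gt0 N i k : adm N i k -> 0 < wt N i k.
Proof.
by move=> a; rewrite /wt a mulr_gt0 ?expR_gt0 ?deg_gt0 ?(adm_half a).
Qed.

Lemma wt_ge0 N i k : 0 <= wt N i k.
Proof.
have [/wt_gt0/ltW//|a] := boolP (adm N i k).
by rewrite /wt (negbTE a).
Qed.

Lemma wt_adm N i k : wt N i k != 0 -> adm N i k.
Proof. by rewrite /wt; case: ifP => //; rewrite eqxx. Qed.

Lemma wt_out N i k : ~~ adm N i k -> wt N i k = 0.
Proof. by rewrite /wt => /negbTE ->. Qed.

Lemma wsum1_gt0 N : 0 < wsum N (fun _ _ => 1).
Proof.
rewrite /wsum big_nat_recl // big_nat_recl //= mulr1.
have h : 0 < wt N 0 0 by apply: wt_gt0; rewrite /adm; lia.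
rewrite -addrA ltr_wpDr //; apply: addr_ge0; apply: sumr_ge0 => j _; last apply: sumr_ge0 => l _.
  by rewrite mulr1 wt_ge0.
by rewrite mulr1 wt_ge0.
Qed.

Lemma wsum_le N f g : (forall i k, adm N i k -> f i k <= g i k) -> wsum N f <= wsum N g.
Proof.
move=> fg; apply: ler_sum => i _; apply: ler_sum => k _.
have [/fg a|a] := boolP (adm N i k); first by rewrite ler_wpM2l ?wt_ge0.
by rewrite wt_out // !mul0r.
Qed.

Lemma wsum_eq N f g : (forall i k, adm N i k -> f i k = g i k) -> wsum N f = wsum N g.
Proof.
by move=> fg; apply/eqP; rewrite eq_le !wsum_le // => i k /fg ->.
Qed.

Lemma wsumD N f g : wsum N (fun i k => f i k + g i k) = wsum N f + wsum N g.
Proof.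
rewrite /wsum -big_split; apply: eq_bigr => i _; rewrite -big_split /=.
by apply: eq_bigr => k _; rewrite mulrDr.
Qed.

Lemma wsumZ N a f : wsum N (fun i k => a * f i k) = a * wsum N f.
Proof.
rewrite /wsum mulr_sumr; apply: eq_bigr => i _; rewrite mulr_sumr.
by apply: eq_bigr => k _; rewrite mulrCA.
Qed.

Lemma av_le N f g : (forall i k, adm N i k -> f i k <= g i k) -> av N f <= av N g.
Proof. by move=> fg; rewrite ler_pM2r ?invr_gt0 ?wsum1_gt0 // wsum_le. Qed.

Lemma av_eq N f g : (forall i k, adm N i k -> f i k = g i k) -> av N f = av N g.
Proof. by move=> fg; rewrite /av (wsum_eq fg). Qed.

Lemma avD N f g : av N (fun i k => f i k + g i k) = av N f + av N g.
Proof. by rewrite /av wsumD mulrDl. Qed.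

Lemma avZ N a f : av N (fun i k => a * f i k) = a * av N f.
Proof. by rewrite /av wsumZ mulrA. Qed.

Lemma avB N f g : av N (fun i k => f i k - g i k) = av N f - av N g.
Proof.
rewrite -[- av N g]mulN1r -avZ -avD; apply: av_eq => i k _; by rewrite mulN1r.
Qed.

Lemma av_cst N a : av N (fun _ _ => a) = a.
Proof.
rewrite (@av_eq N _ (fun _ _ => a * 1)); last by move=> *; rewrite mulr1.
by rewrite avZ /av divff ?mulr1 // gt_eqF // wsum1_gt0.
Qed.

Lemma av_norm N f : `|av N f| <= av N (fun i k => `|f i k|).
Proof.
rewrite ler_norml; apply/andP; split.
  rewrite -mulN1r -avZ; apply: av_le => i k _.
  by rewrite mulN1r lerNl ler_normr lexx orbT.
by apply: av_le => i k _; exact: ler_norm.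
Qed.

(** * Observables of vanishing mean, and calculus up to O(1/N) *)

Definition negl (f : nat -> nat -> nat -> R) := ((fun N => av N (f N)) @ \oo --> 0)%classic.

Lemma invn_cvg0 (C : R) : ((fun N => C / N%:R) @ \oo --> 0)%classic.
Proof.
have inv : (fun N => N%:R^-1 : R) @ \oo --> 0.
  rewrite -(cvg_shiftS (fun n : nat => n%:R^-1 : R)); exact: cvg_harmonic.
by have := cvgM (cvg_cst C) inv; rewrite mulr0; apply.
Qed.

(** The constant C may depend on d, which admits estimates whose coefficient of 1/N blows up as d
    tends to 0. *)
Lemma negl_rate f :
  (forall d, 0 < d -> exists C, forall N, (0 < N)%N -> `|av N (f N)| <= d + C / N%:R) -> negl f.
Proof.
move=> h; apply/cvgr0Pnorm_lt => e e0.
have [C hC] := h (e / 2) ltac:(lra).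
have := invn_cvg0 C => /cvgr0Pnorm_lt /(_ (e / 2) ltac:(lra)) H.
near=> N.
have N0 : (0 < N)%N by near: N; exact: nbhs_infty_gt.
apply: le_lt_trans (hC N N0) _.
have : `|C / N%:R| < e / 2 by near: N; exact: H.
by move/(le_lt_trans (ler_norm _)); lra.
Unshelve. all: by end_near. Qed.

Lemma negl_eps f :
  (forall d, 0 < d -> exists2 g, negl g &
     forall N i k, (0 < N)%N -> adm N i k -> `|f N i k| <= d + g N i k) -> negl f.
Proof.
move=> h; apply/cvgr0Pnorm_lt => e e0.
have [g ng fg] := h (e / 2) ltac:(lra).
move: ng => /cvgr0Pnorm_lt /(_ (e / 2) ltac:(lra)) H.
near=> N.
have N0 : (0 < N)%N by near: N; exact: nbhs_infty_gt.
apply: le_lt_trans (av_norm _ _) _.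
apply: (@le_lt_trans _ _ (e / 2 + av N (g N))).
  rewrite -[X in _ <= X + _](av_cst N) -avD; apply: av_le => i k; exact: fg.
have : `|av N (g N)| < e / 2 by near: N; exact: H.
by move/(le_lt_trans (ler_norm _)); lra.
Unshelve. all: by end_near. Qed.

Lemma neglD f g : negl f -> negl g -> negl (fun N i k => f N i k + g N i k).
Proof.
move=> nf ng; rewrite /negl.
under eq_fun do rewrite avD.
by have := cvgD nf ng; rewrite addr0; apply.
Qed.

Lemma neglZ a f : negl f -> negl (fun N i k => a * f N i k).
Proof.
move=> nf; rewrite /negl; under eq_fun do rewrite avZ.
by have := cvgM (cvg_cst a) nf; rewrite mulr0; apply.
Qed.

Lemma negl_dom f g :
  (forall N i k, (0 < N)%N -> adm N i k -> `|f N i k| <= g N i k) -> negl g -> negl f.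
Proof.
move=> fg ng; apply: negl_eps => d d0; exists g => // N i k N0 a.
by apply: le_trans (fg _ _ _ N0 a) _; rewrite lerDr ltW.
Qed.

(** Rests on z <= d + z^2 / d, valid for every d > 0 and z >= 0. *)
Lemma negl_sqrt f : negl (fun N i k => f N i k ^+ 2) -> negl (fun N i k => `|f N i k|).
Proof.
move=> nf; apply: negl_eps => d d0; exists (fun N i k => d^-1 * f N i k ^+ 2); first exact: neglZ.
move=> N i k _ _; rewrite normr_id -[f N i k ^+ 2]real_normK ?num_real //.
set z := `|f N i k|; have z0 : 0 <= z by exact: normr_ge0.
rewrite -(ler_pM2l d0) mulrDr mulrA divff ?gt_eqF // mul1r.
by nra.
Qed.

Definition bounded (f : nat -> nat -> nat -> R) := exists C : R, forall N i k, (0 < N)%N -> adm N i k -> `|f N i k| <= C.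
(* Bounded and equal up to O(1/N), uniformly over admissible (i, k). *)
Definition cong (f g : nat -> nat -> nat -> R) := [/\ bounded f, bounded g & exists C : R,
   forall N i k, (0 < N)%N -> adm N i k -> `|f N i k - g N i k| <= C / N%:R].

Lemma boundedD f g : bounded f -> bounded g -> bounded (fun N i k => f N i k + g N i k).
Proof.
move=> [C hC] [D hD]; exists (C + D) => N i k N0 a.
by apply: le_trans (ler_normD _ _) _; apply: lerD; [exact: hC|exact: hD].
Qed.

Lemma boundedM f g : bounded f -> bounded g -> bounded (fun N i k => f N i k * g N i k).
Proof.
move=> [C hC] [D hD]; exists (C * D) => N i k N0 a.
by rewrite normrM; apply: ler_pM => //; [exact: hC|exact: hD].
Qed.

Lemma congD f f' g g' : cong f f' -> cong g g' ->
  cong (fun N i k => f N i k + g N i k) (fun N i k => f' N i k + g' N i k).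
Proof.
move=> [bf bf' [C hC]] [bg bg' [D hD]]; split; [exact: boundedD|exact: boundedD|].
exists (C + D) => N i k N0 a; rewrite opprD addrACA mulrDl.
by apply: le_trans (ler_normD _ _) _; apply: lerD; [exact: hC|exact: hD].
Qed.

Lemma congM f f' g g' : cong f f' -> cong g g' ->
  cong (fun N i k => f N i k * g N i k) (fun N i k => f' N i k * g' N i k).
Proof.
move=> [bf bf' [C hC]] [bg bg' [D hD]]; split; [exact: boundedM|exact: boundedM|].
move: bf bg' => [A hA] [B hB].
exists (C * B + A * D) => N i k N0 a.
have -> : f N i k * g N i k - f' N i k * g' N i k =
  (f N i k - f' N i k) * g' N i k + f N i k * (g N i k - g' N i k) by ring.
apply: le_trans (ler_normD _ _) _; rewrite !normrM [X in _ <= X]mulrDl; apply: lerD.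
  rewrite mulrAC; apply: ler_pM => //; [exact: hC|exact: hB].
rewrite -mulrA; apply: ler_pM => //; [exact: hA|exact: hD].
Qed.

Lemma cong_refl f : bounded f -> cong f f.
Proof. by move=> bf; split => //; exists 0 => N i k _ _; rewrite subrr normr0 mul0r. Qed.

Lemma cong_cst a : cong (fun _ _ _ => a) (fun _ _ _ => a).
Proof. by apply: cong_refl; exists `|a|. Qed.

Lemma congN f g : cong f g -> cong (fun N i k => - f N i k) (fun N i k => - g N i k).
Proof.
move=> fg; have := congM (cong_cst (- 1)) fg; congr cong; apply/funext => N; apply/funext => i;
by apply/funext => k; rewrite mulN1r.
Qed.

Lemma cong_sym f g : cong f g -> cong g f.
Proof.
by move=> [bf bg [C hC]]; split => //; exists C => N i k N0 a; rewrite distrC hC.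
Qed.

Lemma cong_inv a : cong (fun N _ _ => a / N%:R) (fun _ _ _ => 0).
Proof.
split; [exists (`|a|)|exists 0|exists (`|a|)] => N i k N0 _; rewrite ?subr0 ?normr0 //.
  rewrite normrM normfV normr_nat ler_piMr // invf_le1 ?ltr0n //.
  by rewrite ler1n.
by rewrite normrM normfV normr_nat.
Qed.

Lemma cong_cvg f g (l : R) : cong f g -> ((fun N => av N (f N)) @ \oo --> l)%classic ->
  ((fun N => av N (g N)) @ \oo --> l)%classic.
Proof.
move=> [_ _ [C hC]] fl.
have n : negl (fun N i k => g N i k - f N i k).
  apply: negl_rate => d d0; exists C => N N0.
  apply: le_trans (av_norm _ _) _.
  apply: (@le_trans _ _ (C / N%:R)); last by rewrite lerDr ltW.
  rewrite -[X in _ <= X](av_cst N); apply: av_le => i k a; rewrite distrC; exact: hC.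
rewrite -[l]add0r.
have -> : (fun N => av N (g N)) =
   (fun N => av N (fun i k => g N i k - f N i k) + av N (f N)).
  by apply/funext => N; rewrite avB subrK.
exact: cvgD.
Qed.

Lemma negl_cong f g : cong f g -> negl f -> negl g.
Proof. exact: cong_cvg. Qed.

Lemma ysc_bnd N i k : (0 < N)%N -> adm N i k -> 0 <= ysc N i <= 1.
Proof.
move=> N0 a; have := adm_half a => iN.
rewrite /ysc; apply/andP; split.
  by rewrite subr_ge0 ler_pdivrMr ?ltr0n // mul1r -natrM ler_nat.
by rewrite gerBl divr_ge0 // mulr_ge0.
Qed.

Lemma ysc_msc N i k : (0 < N)%N ->
  ysc N i / 2 + msc N k = (k%:R - i%:R) / N%:R /\
  ysc N i / 2 - msc N k = (N%:R - i%:R - k%:R) / N%:R.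
Proof.
move=> N0; have n0 : N%:R != 0 :> R by rewrite pnatr_eq0 -lt0n.
by rewrite /ysc /msc; split; field.
Qed.

Lemma msc_bnd N i k : (0 < N)%N -> adm N i k -> - (ysc N i / 2) <= msc N k <= ysc N i / 2.
Proof.
move=> N0 /andP[ik ikN]; have [e1 e2] := ysc_msc i k N0.
have h1 : 0 <= ysc N i / 2 + msc N k by rewrite e1 divr_ge0 // subr_ge0 ler_nat.
have h2 : 0 <= ysc N i / 2 - msc N k.
  by rewrite e2 divr_ge0 // -addrA -opprD subr_ge0 -natrD ler_nat.
by lra.
Qed.

Lemma xsc_bnd N i k : (0 < N)%N -> adm N i k -> 0 <= xsc N i k <= ysc N i ^+ 2 / 4.
Proof.
move=> N0 a; have := msc_bnd N0 a; have := ysc_bnd N0 a; rewrite /xsc; nra.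
Qed.

Lemma bounded_y : bounded (fun N i _ => ysc N i).
Proof. by exists 1 => N i k N0 a; have := ysc_bnd N0 a; rewrite ler_norml; lra. Qed.

Lemma bounded_m : bounded (fun N _ k => msc N k).
Proof.
exists 1 => N i k N0 a; have := msc_bnd N0 a; have := ysc_bnd N0 a; rewrite ler_norml; lra.
Qed.

Lemma bounded_x : bounded xsc.
Proof.
exists 1 => N i k N0 a; have := xsc_bnd N0 a; have := ysc_bnd N0 a; rewrite ler_norml; nra.
Qed.

End Gibbs.

(** * Shift identities *)

Section Shift.
Local Open Scope classical_set_scope.
Local Open Scope ring_scope.
Variables (R : realType) (b m0 : R).
Implicit Types (N i k : nat).
Local Notation wN := (wt b m0).
Local Notation mean := (av b m0).
Local Notation null := (negl b m0).
Local Notation yN := (@ysc R).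
Local Notation mN := (@msc R).
Local Notation xN := (@xsc R).

(** The linear term + M of the S_+S_- eigenvalue cancels the 1 in (M + 1)^2 - M^2, so the exponent
    has no 1/N correction. *)
Lemma wtS_k N i k : (0 < N)%N -> adm N i k -> adm N i k.+1 ->
  wN N i k.+1 = wN N i k * expR (b * (m0 - mN N k)).
Proof.
move=> N0 a a'; rewrite /wt a a' -mulrA -expRD; congr (_ * expR _).
have n0 : N%:R != 0 :> R by rewrite pnatr_eq0 -lt0n.
by rewrite /logw /spinM /msc -[k.+1%:R]natr1; field.
Qed.

Lemma degS N i : (2 * i.+1 <= N)%N ->
  deg R N i * ((N%:R - i%:R + 1) * (N%:R - 2 * i%:R - 1)) =
  deg R N i.+1 * ((i%:R + 1) * (N%:R - 2 * i%:R + 1)).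
Proof.
move=> iN; rewrite /deg.
have := mul_bin_left N.+1 i => /(congr1 (fun n : nat => n%:R : R)).
rewrite !natrM natrB; last by lia.
rewrite -[i.+1%:R]natr1 -[N.+1%:R]natr1 => e.
have n0 : N%:R + 1 != 0 :> R by rewrite natr1 pnatr_eq0.
have -> : 'C(N.+1, i.+1)%:R * (N%:R + 1 - 2 * (i%:R + 1)) / (N%:R + 1) *
  ((i%:R + 1) * (N%:R - 2 * i%:R + 1)) = ((i%:R + 1) * 'C(N.+1, i.+1)%:R) *
   (N%:R + 1 - 2 * (i%:R + 1)) / (N%:R + 1) * (N%:R - 2 * i%:R + 1) :> R by ring.
by rewrite e; field.
Qed.

Lemma adm_pred N i k : adm N i.+1 k -> adm N i k.
Proof. by rewrite /adm; lia. Qed.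

Lemma wtS_i N i k : (0 < N)%N -> adm N i.+1 k ->
  wN N i k * ((N%:R - i%:R + 1) * (N%:R - 2 * i%:R - 1)) =
  wN N i.+1 k * ((i%:R + 1) * (N%:R - 2 * i%:R + 1)) * expR (b * yN N i / 2).
Proof.
move=> N0 a; rewrite /wt a (adm_pred a) mulrAC degS; last exact: adm_half a.
rewrite mulrAC -[RHS]mulrA [_ * expR (b * yN N i / 2)]mulrC mulrA -[in RHS]mulrA.
have n0 : N%:R != 0 :> R by rewrite pnatr_eq0 -lt0n.
have -> : logw b m0 N (spinJ R N i * (spinJ R N i + 1)) (spinM R N k) =
  logw b m0 N (spinJ R N i.+1 * (spinJ R N i.+1 + 1)) (spinM R N k) + b * yN N i / 2.
  by rewrite /logw /spinJ /ysc -[i.+1%:R]natr1; field.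
by rewrite expRD; ring.
Qed.

(** The two prefactors are the eigenvalues of S_+S_- and S_-S_+ over N^2. The first vanishes at M =
    -J and the second at M = J, so shifting M inside a multiplet leaves no boundary term. *)
Lemma shift_m N (F : R -> R) : (0 < N)%N ->
  mean N (fun i k => (yN N i / 2 + mN N k) * (yN N i / 2 - mN N k + 1 / N%:R) * F (mN N k)) =
  mean N (fun i k => (yN N i / 2 - mN N k) * (yN N i / 2 + mN N k + 1 / N%:R) *
     expR (b * (m0 - mN N k)) * F (mN N k + 1 / N%:R)).
Proof.
move=> N0; rewrite /av /wsum; congr (_ / _); apply: eq_bigr => i _.
have n0 : N%:R != 0 :> R by rewrite pnatr_eq0 -lt0n.
have mS k : mN N k.+1 = mN N k + 1 / N%:R by rewrite /msc -[k.+1%:R]natr1; field.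
apply: sum_shift.
- have [/andP[i0 _]|a] := boolP (adm N i 0); last by rewrite wt_out ?mul0r.
  move: i0; rewrite leqn0 => /eqP ->.
  have [-> _] := ysc_msc R 0 0 N0; by rewrite subrr !mul0r mulr0.
- have [/andP[_ i0]|a] := boolP (adm N i N); last by rewrite wt_out ?mul0r.
  have -> : i = 0%N by lia.
  have [_ ->] := ysc_msc R 0 N N0; by rewrite subr0 subrr !mul0r mulr0.
- move=> k kN; rewrite mS.
  have -> : yN N i / 2 - (mN N k + 1 / N%:R) + 1 / N%:R = yN N i / 2 - mN N k by ring.
  have [e1 e2] := ysc_msc R i k N0.
  have [a|na] := boolP (adm N i k); have [a'|na'] := boolP (adm N i k.+1).
  + by rewrite wtS_k //; ring.
  + rewrite (wt_out _ _ na') mul0r.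
    have -> : yN N i / 2 - mN N k = 0.
      rewrite e2; move: a na'; rewrite /adm => a na'.
      have -> : N = (i + k)%N by lia.
      by rewrite natrD -addrA -opprD subrr mul0r.
    by rewrite !mul0r mulr0.
  + rewrite (wt_out _ _ na) mul0r addrA.
    have -> : yN N i / 2 + mN N k + 1 / N%:R = 0.
      rewrite e1; move: na a'; rewrite /adm => na a'.
      have -> : i = k.+1 by lia.
      by rewrite -mulrDl -natr1; ring.
    by rewrite !mul0r mulr0.
  + by rewrite !wt_out // !mul0r.
Qed.

(** At fixed M the range of J ends at |M|, where J^2 - M^2 vanishes, and at N/2, where 1/2 - y/2 =
    i/N does. The other factors multiplying F come from the ratio in [wtS_i], rescaled by N. *)
Lemma shift_j N (F : R -> R) : (0 < N)%N ->
  mean N (fun i k => xN N i k * (1 / 2 + yN N i / 2 + 1 / N%:R) * (yN N i - 1 / N%:R) * F (yN N i)) =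
  mean N (fun i k => ((yN N i / 2 + 1 / N%:R) ^+ 2 - mN N k ^+ 2) * (1 / 2 - yN N i / 2) *
    (yN N i + 3 / N%:R) * expR (b * (yN N i / 2 + 1 / N%:R)) * F (yN N i + 2 / N%:R)).
Proof.
move=> N0; rewrite /av /wsum; congr (_ / _).
rewrite exchange_big /= [RHS]exchange_big /=; apply: eq_bigr => k _.
have n0 : N%:R != 0 :> R by rewrite pnatr_eq0 -lt0n.
have yS i : yN N i = yN N i.+1 + 2 / N%:R by rewrite /ysc -[i.+1%:R]natr1; field.
symmetry; apply: sum_shift.
- have -> : yN N 0 = 1 by rewrite /ysc mulr0 mul0r subr0.
  by rewrite subrr mulr0 !mul0r mulr0.
- by rewrite wt_out ?mul0r // /adm; lia.
- move=> i iN; rewrite -yS.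
  have -> : yN N i.+1 / 2 + 1 / N%:R = yN N i / 2 by rewrite (yS i); field.
  have -> : yN N i.+1 = yN N i - 2 / N%:R by rewrite (yS i) addrK.
  have [e1 e2] := ysc_msc R i k N0.
  have [a'|na'] := boolP (adm N i.+1 k).
    have := wtS_i N0 a'.
    move: (wN N i k) (wN N i.+1 k) => w w' e.
    rewrite /xsc; set X := _ - _ ^+ 2.
    have E : expR (b * (yN N i / 2)) = expR (b * yN N i / 2) by rewrite mulrA.
    rewrite E.
    apply: (@mulIf _ (N%:R ^+ 2)); first by rewrite expf_neq0.
    have l : w' * (X * (1 / 2 - (yN N i - 2 / N%:R) / 2) * (yN N i - 2 / N%:R + 3 / N%:R) *
       expR (b * yN N i / 2) * F (yN N i)) * N%:R ^+ 2 =
       X * F (yN N i) * (w' * ((i%:R + 1) * (N%:R - 2 * i%:R + 1)) * expR (b * yN N i / 2)).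
      by rewrite /ysc; field.
    rewrite l -e.
    by rewrite /ysc; field.
  rewrite (wt_out _ _ na') mul0r.
  have [a|na] := boolP (adm N i k); last by rewrite wt_out ?mul0r.
  have -> : xN N i k = 0.
    have -> : xN N i k = (yN N i / 2 + mN N k) * (yN N i / 2 - mN N k) by rewrite /xsc; ring.
    rewrite e1 e2; move: a na'; rewrite /adm => a na'.
    have [->|->] : k = i \/ N = (i + k)%N by lia.
      by rewrite subrr !mul0r.
    by rewrite natrD -[X in _ * (X / _)]addrA -opprD subrr mul0r mulr0.
  by rewrite !mul0r mulr0.
Qed.

Hypothesis b_gt0 : 0 < b.

(** The test function in [shift_m] is v = m - m0. Up to O(1/N) both sides carry the weight x, and
    their difference is the mean of x v (1 - exp(-b v)), which dominates a multiple of x v^2. *)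
Lemma negl_x_msc : null (fun N i k => xN N i k * (mN N k - m0) ^+ 2).
Proof.
pose L N i k := (yN N i / 2 + mN N k) * (yN N i / 2 - mN N k + 1 / N%:R) * (mN N k - m0).
pose Q N i k := (yN N i / 2 - mN N k) * (yN N i / 2 + mN N k + 1 / N%:R) *
     expR (b * (m0 - mN N k)) * (mN N k + 1 / N%:R - m0).
have n1 : null (fun N i k => L N i k - Q N i k).
  apply: negl_rate => d d0; exists 0 => N N0.
  rewrite avB /L /Q (@shift_m N (fun x => x - m0)) // subrr normr0 mul0r addr0; exact: ltW.
have cy : cong (fun N i _ => yN N i / 2) (fun N i _ => yN N i / 2).
  by apply: congM; [exact/cong_refl/bounded_y | exact: cong_cst].
have cm : cong (fun N _ k => mN N k) (fun N _ k => mN N k) by exact/cong_refl/bounded_m.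
have c0 : cong (fun N _ _ => 1 / N%:R) (fun _ _ _ => 0 : R) by exact: cong_inv.
have ce : cong (fun N _ k => expR (b * (m0 - mN N k))) (fun N _ k => expR (b * (m0 - mN N k))).
  apply: cong_refl; exists (expR (b * (m0 + 1))) => N i k N0 a.
  rewrite gtr0_norm ?expR_gt0 // ler_expR ler_pM2l // lerD2l.
  have := msc_bnd R N0 a; have := ysc_bnd R N0 a; lra.
have cLQ : cong (fun N i k => L N i k - Q N i k)
  (fun N i k => (yN N i / 2 + mN N k) * (yN N i / 2 - mN N k + 0) * (mN N k - m0) -
    (yN N i / 2 - mN N k) * (yN N i / 2 + mN N k + 0) * expR (b * (m0 - mN N k)) *
     (mN N k + 0 - m0)).
  apply: congD; last apply: congN.
    apply: congM; last by apply: congD => //; exact: cong_cst.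
    by apply: congM; [exact: congD|apply: congD => //; apply: congD => //; exact: congN].
  apply: congM; last by apply: congD; [exact: congD|exact: cong_cst].
  apply: congM => //; apply: congM; first by apply: congD => //; exact: congN.
  by apply: congD => //; apply: congD.
have n2 := negl_cong cLQ n1.
(* From 1 - exp(-s) >= s / (1 + s) for s >= 0, together with |v| <= |m0| + 1; for v < 0 even the
   larger constant b works. *)
pose K := b * (1 + b * (`|m0| + 1))^-1.
have K1 : 0 < 1 + b * (`|m0| + 1) by rewrite addr_gt0 // mulr_gt0 // ltr_wpDl.
have K0 : 0 < K by rewrite mulr_gt0 // invr_gt0.
apply: negl_dom (neglZ K^-1 n2) => N i k N0 a /=.
rewrite !addr0.
have -> : (yN N i / 2 + mN N k) * (yN N i / 2 - mN N k) * (mN N k - m0) -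
    (yN N i / 2 - mN N k) * (yN N i / 2 + mN N k) * expR (b * (m0 - mN N k)) *
     (mN N k - m0) = xN N i k * ((mN N k - m0) * (1 - expR (- (b * (mN N k - m0))))).
  have -> : b * (m0 - mN N k) = - (b * (mN N k - m0)) by ring.
  by rewrite /xsc; ring.
have /andP[x0 _] := xsc_bnd R N0 a.
rewrite ger0_norm; last by rewrite mulr_ge0 // sqr_ge0.
rewrite [X in _ <= X]mulrCA ler_wpM2l //.
rewrite ler_pdivlMl //.
set v := mN N k - m0.
have vb : `|v| <= `|m0| + 1.
  have h : `|mN N k| <= 1.
    have := msc_bnd R N0 a; have := ysc_bnd R N0 a; rewrite ler_norml; lra.
  by apply: le_trans (ler_normB _ _) _; rewrite addrC lerD2l.
rewrite /K -mulrA [_^-1 * _]mulrC mulrA ler_pdivrMr //.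
have [v0|v0] := leP 0 v.
  rewrite expr2 mulrCA -mulrA ler_wpM2l //.
  have := expR_ge1Dx (b * v) => h.
  have h1 : 0 < 1 + b * v by rewrite ltr_pwDl // mulr_ge0 // ltW.
  have h2 : expR (- (b * v)) <= (1 + b * v)^-1.
    by rewrite expRN lef_pV2 ?posrE ?expR_gt0.
  apply: (@le_trans _ _ ((1 - (1 + b * v)^-1) * (1 + b * (`|m0| + 1)))).
    have -> : 1 - (1 + b * v)^-1 = b * v / (1 + b * v) by field; rewrite gt_eqF.
    rewrite mulrAC ler_pdivlMr // ler_wpM2l //; first by rewrite mulr_ge0 // ltW.
    by rewrite lerD2l ler_pM2l // (le_trans (ler_norm v)).
  by rewrite ler_pM2r // lerB.
have h : 1 - b * v <= expR (- (b * v)) by have := expR_ge1Dx (- (b * v)); lra.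
have h2 : b * v ^+ 2 <= v * (1 - expR (- (b * v))).
  have -> : b * v ^+ 2 = v * (b * v) by ring.
  by rewrite ler_nM2l //; lra.
apply: le_trans h2 _; rewrite ler_peMr //.
  apply: mulr_le0; first exact: ltW.
  have : b * v <= 0 by rewrite mulr_ge0_le0 // ltW.
  by lra.
by rewrite lerDl mulr_ge0 // ?ltW // ltr_wpDl.
Qed.

(** The test function in [shift_j] is y - y1. The separation in [gap_sep] degenerates like y^2 and
    the prefactor contributes one more y; as x <= y^2 / 4, the factor x^2 is below y^3 / 6, which
    explains the cube of x. *)
Lemma negl_x_ysc y1 : gap_sep b y1 -> null (fun N i k => xN N i k ^+ 3 * (yN N i - y1) ^+ 2).
Proof.
move=> [y10 y11 glo ghi].
pose L N i k := xN N i k * (1 / 2 + yN N i / 2 + 1 / N%:R) * (yN N i - 1 / N%:R) * (yN N i - y1).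
(* The exponential is split so that its part with exponent b/N can be replaced by 1; squares are
   spelled as products to fit [congM]. *)
pose Q N i k := ((yN N i / 2 + 1 / N%:R) * (yN N i / 2 + 1 / N%:R) - mN N k * mN N k) * (1 / 2 - yN N i / 2) *
    (yN N i + 3 / N%:R) * (expR (b * (yN N i / 2)) * expR (b / N%:R)) * (yN N i + 2 / N%:R - y1).
have n1 : null (fun N i k => L N i k - Q N i k).
  apply: negl_rate => d d0; exists 0 => N N0.
  rewrite avB /L (@shift_j N (fun x => x - y1)) // /Q mul0r addr0.
  rewrite -avB (@av_eq _ _ _ _ _ (fun _ _ => 0)); first by rewrite av_cst normr0 ltW.
  move=> i k a.
  have -> : b * (yN N i / 2 + 1 / N%:R) = b * (yN N i / 2) + b / N%:R by ring.
  by rewrite expRD; ring.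
have cy : cong (fun N i _ => yN N i) (fun N i _ => yN N i) by exact/cong_refl/bounded_y.
have cy2 : cong (fun N i _ => yN N i / 2) (fun N i _ => yN N i / 2).
  by apply: congM => //; exact: cong_cst.
have cm : cong (fun N _ k => mN N k) (fun N _ k => mN N k) by exact/cong_refl/bounded_m.
have cx : cong xN xN by exact/cong_refl/bounded_x.
have c0 (a : R) : cong (fun N _ _ => a / N%:R) (fun _ _ _ => 0 : R) by exact: cong_inv.
have ce : cong (fun N i _ => expR (b * (yN N i / 2))) (fun N i _ => expR (b * (yN N i / 2))).
  apply: cong_refl; exists (expR (b * 1)) => N i k N0 a.
  rewrite gtr0_norm ?expR_gt0 // ler_expR ler_pM2l //.
  have := ysc_bnd R N0 a; lra.
have ce0 : cong (fun N _ _ => expR (b / N%:R)) (fun _ _ _ => 1 : R).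
  have bN N : (0 < N)%N -> 0 <= b / N%:R <= b.
    move=> N0; apply/andP; split; first by rewrite divr_ge0 // ltW.
    rewrite ler_pdivrMr ?ltr0n // ler_peMr //; first exact: ltW.
    by rewrite ler1n.
  split; [exists (expR b)|exists 1|exists (b * expR b)] => N i k N0 _; rewrite ?normr1 //.
    by rewrite gtr0_norm ?expR_gt0 // ler_expR; have := bN N N0; lra.
  have /andP[q0 q1] := bN N N0.
  rewrite ger0_norm; last by have := expR_ge1Dx (b / N%:R); lra.
  apply: le_trans (expR_sub1_le _) _.
  by rewrite mulrAC ler_pM2r ?invr_gt0 ?ltr0n // ler_pM2l // ler_expR.
have cLQ : cong (fun N i k => L N i k - Q N i k)
  (fun N i k => xN N i k * (1 / 2 + yN N i / 2 + 0) * (yN N i - 0) * (yN N i - y1) -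
    ((yN N i / 2 + 0) * (yN N i / 2 + 0) - mN N k * mN N k) * (1 / 2 - yN N i / 2) *
    (yN N i + 0) * (expR (b * (yN N i / 2)) * 1) * (yN N i + 0 - y1)).
  apply: congD; last apply: congN.
    apply: congM; last by apply: congD => //; exact: cong_cst.
    apply: congM; last by apply: congD => //; exact: congN.
    by apply: congM => //; apply: congD => //; apply: congD => //; exact: cong_cst.
  apply: congM; last by apply: congD; [exact: congD|exact: cong_cst].
  apply: congM; last exact: congM.
  apply: congM; last exact: congD.
  apply: congM; last by apply: congD; [exact: cong_cst|exact: congN].
  by apply: congD; [apply: congM; exact: congD|apply: congN; exact: congM].
have n2 := negl_cong cLQ n1.
apply: negl_dom (neglZ 1 n2) => N i k N0 a /=.
have /andP[x0 x1] := xsc_bnd R N0 a.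
have /andP[y0 y_1] := ysc_bnd R N0 a.
rewrite mul1r !addr0 subr0 mulr1.
set y := yN N i in x1 y0 y_1 *; set X := xN N i k.
have -> : X * (1 / 2 + y / 2) * y * (y - y1) -
   (y / 2 * (y / 2) - mN N k * mN N k) * (1 / 2 - y / 2) * y * expR (b * (y / 2)) * (y - y1) =
   X * y / 2 * ((y - y1) * ((1 + y) - (1 - y) * expR (b * y / 2))).
  by rewrite /X /xsc -/y -[b * y / 2]mulrA; field.
have key : 3^-1 * y ^+ 2 * (y - y1) ^+ 2 <= (y - y1) * ((1 + y) - (1 - y) * expR (b * y / 2)).
  have [e|ne] := eqVneq y y1; first by rewrite e subrr expr0n /= mulr0 mul0r.
  have [yy1|y1y] := ltP y y1.
    have [->|yn0] := eqVneq y 0; first by rewrite expr0n /= !mulr0 !mul0r expR0; lra.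
    have yp : 0 < y by rewrite lt_def yn0.
    have h := glo y yp yy1.
    have h1 : (1 + y) - (1 - y) * expR (b * y / 2) <= - (3^-1 * y ^+ 2 * (y1 - y)).
      have : 0 <= y ^+ 2 * (y1 - y) by rewrite mulr_ge0 ?sqr_ge0 //; lra.
      have : 0 <= y * (y ^+ 2 * (y1 - y)) by rewrite !mulr_ge0 ?sqr_ge0 //; lra.
      lra.
    have -> : 3^-1 * y ^+ 2 * (y - y1) ^+ 2 = (y - y1) * - (3^-1 * y ^+ 2 * (y1 - y)) by ring.
    by rewrite ler_nM2l //; lra.
  have yp : y1 < y by rewrite lt_def ne.
  have h := ghi y yp y_1.
  have h1 : 3^-1 * y ^+ 2 * (y - y1) <= (1 + y) - (1 - y) * expR (b * y / 2).
    have : 0 <= y * (y ^+ 2 * (y - y1)) by rewrite !mulr_ge0 ?sqr_ge0 //; lra.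
    lra.
  have -> : 3^-1 * y ^+ 2 * (y - y1) ^+ 2 = (y - y1) * (3^-1 * y ^+ 2 * (y - y1)) by ring.
  by rewrite ler_pM2l //; lra.
rewrite ger0_norm; last by rewrite mulr_ge0 ?sqr_ge0 // exprn_ge0.
apply: (@le_trans _ _ (X * y / 2 * (3^-1 * y ^+ 2 * (y - y1) ^+ 2))); last first.
  by rewrite ler_wpM2l // mulr_ge0 // mulr_ge0.
have -> : X * y / 2 * (3^-1 * y ^+ 2 * (y - y1) ^+ 2) = X * (y ^+ 3 / 6) * (y - y1) ^+ 2 by field.
rewrite ler_wpM2r ?sqr_ge0 // exprS ler_wpM2l //.
have X2 : X ^+ 2 <= (y ^+ 2 / 4) ^+ 2 by rewrite lerXn2r ?nnegrE //; nra.
apply: le_trans X2 _.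
have : y ^+ 4 <= y ^+ 3 by rewrite exprS ler_piMl // exprn_ge0.
have : 0 <= y ^+ 3 by rewrite exprn_ge0.
by rewrite expr_div_n -exprM /=; lra.
Qed.

End Shift.

(** * Drift estimates and concentration *)

Section Drift.
Local Open Scope classical_set_scope.
Local Open Scope ring_scope.
Variables (R : realType) (b m0 : R).
Hypothesis b_gt0 : 0 < b.
Implicit Types (N i k : nat).
Local Notation wN := (wt b m0).
Local Notation mean := (av b m0).
Local Notation null := (negl b m0).
Local Notation yN := (@ysc R).
Local Notation mN := (@msc R).
Local Notation xN := (@xsc R).

Definition pospart (x : R) : R := Num.max 0 x.

Lemma pospart_ge0 x : 0 <= pospart x.
Proof. by rewrite /pospart le_max lexx. Qed.

Lemma pospart_ge x : x <= pospart x.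
Proof. by rewrite /pospart le_max lexx orbT. Qed.

Lemma pospart_eq0 x : x <= 0 -> pospart x = 0.
Proof. by move=> x0; rewrite /pospart max_l. Qed.

Lemma pospart_gt0 x : 0 < pospart x -> pospart x = x /\ 0 < x.
Proof.
rewrite /pospart; have [x0|x0] := leP x 0; first by rewrite ltxx.
by [].
Qed.

Lemma pospart_inc x y h : 0 <= h -> y <= x + h -> pospart y <= pospart x + h.
Proof.
move=> h0 yx; rewrite {1}/pospart ge_max addr_ge0 ?pospart_ge0 //=.
by apply: le_trans yx _; rewrite lerD2r pospart_ge.
Qed.

Lemma av_bound_m N (q : nat -> nat -> R) D :
  (forall i, \sum_(0 <= k < N.+1) wN N i k * q i k <= D * \sum_(0 <= k < N.+1) wN N i k) ->
  mean N q <= D.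
Proof.
move=> H; rewrite /av ler_pdivrMr ?wsum1_gt0 // /wsum mulr_sumr; apply: ler_sum => i _.
apply: le_trans (H i) _; rewrite le_eqVlt; apply/orP; left; apply/eqP; congr (_ * _).
by apply: eq_bigr => k _; rewrite mulr1.
Qed.

Lemma av_bound_j N (q : nat -> nat -> R) D :
  (forall k, \sum_(0 <= i < N.+1) wN N i k * q i k <= D * \sum_(0 <= i < N.+1) wN N i k) ->
  mean N q <= D.
Proof.
move=> H; rewrite /av ler_pdivrMr ?wsum1_gt0 // /wsum exchange_big /=.
rewrite [X in _ <= _ * X]exchange_big /= mulr_sumr; apply: ler_sum => k _.
apply: le_trans (H k) _; rewrite le_eqVlt; apply/orP; left; apply/eqP; congr (_ * _).
by apply: eq_bigr => i _; rewrite mulr1.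
Qed.

Lemma mscS N k : (0 < N)%N -> mN N k.+1 = mN N k + 1 / N%:R.
Proof.
move=> N0; have n0 : N%:R != 0 :> R by rewrite pnatr_eq0 -lt0n.
by rewrite /msc -[k.+1%:R]natr1; field.
Qed.

Lemma msc_gt0 N k : (0 < N)%N -> 0 < mN N k -> (N < 2 * k)%N.
Proof.
move=> N0; rewrite /msc subr_gt0 ltr_pdivlMr ?ltr0n // => h.
rewrite -(ltr_nat R) natrM; lra.
Qed.

Lemma msc_rev N k : (0 < N)%N -> (k <= N)%N -> mN N (N - k) = - mN N k.
Proof.
move=> N0 kN; have n0 : N%:R != 0 :> R by rewrite pnatr_eq0 -lt0n.
by rewrite /msc natrB //; field.
Qed.

(** The test function is f = (m - |m0|)_+, with drift rate b f because exp(b f) >= 1 + b f. Wherever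
    f > 0 one has N < 2k, and in that range admissibility of k.+1 implies that of k. *)
Lemma drift_m N (p : nat -> R) : (0 < N)%N ->
  (forall k, 0 <= p k) -> p N.+1 = 0 ->
  (forall k, p k.+1 != 0 -> (N < 2 * k)%N -> p k.+1 * expR (b * (mN N k - `|m0|)) <= p k) ->
  \sum_(0 <= k < N.+1) p k * pospart (mN N k - `|m0|) ^+ 2 <=
   ((2 / b + 2) / N%:R) * \sum_(0 <= k < N.+1) p k.
Proof.
move=> N0 p0 pN pS.
have nN : 0 < N%:R :> R by rewrite ltr0n.
have n1 : 1 / N%:R <= 1 :> R by rewrite ler_pdivrMr // mul1r ler1n.
have n2 : 0 <= 1 / N%:R :> R by rewrite divr_ge0.
pose f k := pospart (mN N k - `|m0|).
have f0 : f 0 = 0.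
  by rewrite /f pospart_eq0 // /msc mul0r; have := normr_ge0 m0; lra.
have fS k : f k.+1 <= f k + 1 / N%:R.
  by apply: pospart_inc => //; rewrite mscS //; lra.
apply: le_trans (@drift R N p f (fun k => b * f k) (fun k => f k ^+ 2) (2 / b)
  (2 * (1 / N%:R) ^+ 2) (1 / N%:R) p0 pN f0 _ fS n2 _ _ _ _ _) _.
- by move=> k; exact: pospart_ge0.
- by rewrite divr_ge0 // ltW.
- move=> k pk fk; have [fE m_gt] := pospart_gt0 fk.
  have := pS k pk; move=> /(_ (msc_gt0 N0 _)); have := normr_ge0 m0 => m00.
  move=> /(_ ltac:(lra)); apply: le_trans.
  rewrite mulrC ler_wpM2l // /f fE; exact: expR_ge1Dx.
- by rewrite f0 expr0n.
- move=> k _; have -> : 2 / b * (b * f k * f k) = 2 * f k ^+ 2 by field; rewrite gt_eqF.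
  apply: (@le_trans _ _ ((f k + 1 / N%:R) ^+ 2)).
    by rewrite lerXn2r ?nnegrE ?addr_ge0 ?pospart_ge0.
  by have := sqr_ge0 (f k - 1 / N%:R); lra.
- by rewrite mulr_ge0 // sqr_ge0.
apply: ler_wpM2r; first exact: sumr_ge0.
have -> : (2 / b + 2) / N%:R = 2 / b * (1 / N%:R) + 2 * (1 / N%:R) by ring.
rewrite lerD2l ler_pM2l //; by rewrite expr2 ler_piMr.
Qed.

Lemma drift_m_rate f :
  (forall N, (0 < N)%N -> mean N (f N) <= (2 / b + 2) / N%:R) ->
  (forall N i k, 0 <= f N i k) -> null f.
Proof.
move=> h f0; apply: negl_rate => d d0; exists (2 / b + 2) => N N0.
have h0 : 0 <= mean N (f N).
  by rewrite -(av_cst b m0 N 0); apply: av_le => i k _.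
rewrite ger0_norm //; apply: le_trans (h N N0) _; by rewrite lerDr ltW.
Qed.

Lemma negl_m_up : null (fun N _ k => pospart (mN N k - `|m0|) ^+ 2).
Proof.
apply: drift_m_rate => [N N0|N i k]; last exact: sqr_ge0.
apply: av_bound_m => i; apply: drift_m => //.
- by move=> k; exact: wt_ge0.
- by rewrite wt_out // /adm; lia.
- move=> k /wt_adm a kN.
  have a' : adm N i k by move: a; rewrite /adm; lia.
  rewrite wtS_k // -mulrA -expRD -[X in _ <= X]mulr1 ler_wpM2l ?wt_ge0 //.
  rewrite -[X in _ <= X](@expR0 R) ler_expR -mulrDr.
  by rewrite pmulr_rle0 //; have := ler_norm m0; lra.
Qed.

Lemma negl_m_down : null (fun N _ k => pospart (- mN N k - `|m0|) ^+ 2).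
Proof.
apply: drift_m_rate => [N N0|N i k]; last exact: sqr_ge0.
apply: av_bound_m => i.
(* Reflection M -> -M. The cutoff matters at k = N + 1, where truncated subtraction would return the
   weight at index 0 instead of 0. *)
pose p k := if (k <= N)%N then wN N i (N - k) else 0.
rewrite big_nat_rev /= [X in _ <= _ * X]big_nat_rev /=.
rewrite (@eq_big_nat _ _ _ _ _ _ (fun k => p k * pospart (mN N k - `|m0|) ^+ 2)); last first.
  by move=> k /andP[_ kN]; rewrite add0n subSS /p -ltnS kN msc_rev ?opprK.
rewrite [X in _ <= _ * X](@eq_big_nat _ _ _ _ _ _ p); last first.
  by move=> k /andP[_ kN]; rewrite add0n subSS /p -ltnS kN.
apply: drift_m => //.
- by move=> k; rewrite /p; case: ifP => // _; exact: wt_ge0.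
- by rewrite /p ltnn.
- move=> k; rewrite /p; case: ifP; last by rewrite eqxx.
  move=> kN /wt_adm a k2; rewrite (ltnW kN).
  have e : (N - k = (N - k.+1).+1)%N by lia.
  have a' : adm N i (N - k.+1).+1 by move: a; rewrite /adm; lia.
  rewrite [X in _ <= wN _ _ X]e wtS_k // ler_wpM2l ?wt_ge0 // ler_expR ler_pM2l //.
  rewrite msc_rev // opprK mscS //.
  have : 0 <= 1 / N%:R :> R by rewrite divr_ge0.
  by have := ler_norm (- m0); rewrite normrN; lra.
Qed.

(** With u = N y, binomial and exponential factors give 1 + s by [gap_sep], and the factor N + 1 -
    2i = u + 1 of the multiplicity gives (u + 1) / (u - 1) >= 1 + 2 / u. The latter keeps the drift
    effective near y = 0, where s is of order y^2. *)
Lemma drift_j_ratio N i k y1 : (0 < N)%N -> gap_sep b y1 -> adm N i.+1 k ->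
  yN N i < y1 ->
  (1 + (2 / 3 * yN N i ^+ 2 * (y1 - yN N i) + 2 / (N%:R * yN N i))) * wN N i.+1 k <= wN N i k.
Proof.
move=> N0 [y10 y11 glo _] a yy1.
have nN : 0 < N%:R :> R by rewrite ltr0n.
have u2 : 2 <= N%:R * yN N i.
  have -> : N%:R * yN N i = N%:R - 2 * i%:R by rewrite /ysc; field; rewrite gt_eqF.
  have := adm_half a; rewrite -(ler_nat R) natrM -natr1; lra.
have y0 : 0 < yN N i by rewrite -(pmulr_rgt0 _ nN); lra.
have := wtS_i b m0 N0 a; have := glo _ y0 yy1.
have -> : N%:R - i%:R + 1 = N%:R * (1 + yN N i) / 2 + 1 :> R by rewrite /ysc; field; rewrite gt_eqF.
have -> : i%:R + 1 = N%:R * (1 - yN N i) / 2 + 1 :> R by rewrite /ysc; field; rewrite gt_eqF.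
have -> : N%:R - 2 * i%:R = N%:R * yN N i :> R by rewrite /ysc; field; rewrite gt_eqF.
set y := yN N i in yy1 u2 y0 *; set e := expR _; set s := 2 / 3 * y ^+ 2 * (y1 - y).
move=> es eq.
have s0 : 0 <= s by rewrite /s !(sqr_ge0, mulr_ge0) //; lra.
have y_1 : 0 < 1 - y by lra.
(* Absorbs the additive + 1 in both factors of the finite-N ratio. *)
have e1 : 1 + s <= e.
  rewrite -(ler_pM2l y_1); apply: le_trans es; rewrite ler_wpM2r //; lra.
set P := N%:R * (1 + y) / 2 + 1 in eq *.
have P0 : 0 < P by rewrite /P addr_gt0 // divr_gt0 // mulr_gt0 //; lra.
set u := N%:R * y in u2 eq *.
have st1 : (1 + s) * P <= (N%:R * (1 - y) / 2 + 1) * e.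
  have : N%:R / 2 * ((1 + y) * (1 + s)) <= N%:R / 2 * ((1 - y) * e).
    by rewrite ler_pM2l // divr_gt0.
  by rewrite /P; lra.
have st2 : (1 + (s + 2 / u)) * (u - 1) <= (1 + s) * (u + 1).
  have -> : (1 + (s + 2 / u)) * (u - 1) = (1 + s) * (u - 1) + 2 - 2 / u by field; rewrite gt_eqF //; lra.
  have : 0 <= 2 / u by rewrite divr_ge0 //; lra.
  by lra.
have u1 : 0 < u - 1 by lra.
rewrite -(ler_pM2r (mulr_gt0 P0 u1)) eq.
have w0 := wt_ge0 b m0 N i.+1 k.
have -> : (1 + (s + 2 / u)) * wN N i.+1 k * (P * (u - 1)) = wN N i.+1 k * (P * ((1 + (s + 2 / u)) * (u - 1))).
  by ring.
rewrite -mulrA ler_wpM2l //.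
apply: (@le_trans _ _ (P * ((1 + s) * (u + 1)))); first by rewrite ler_pM2l.
have -> : (N%:R * (1 - y) / 2 + 1) * (u + 1) * e = ((N%:R * (1 - y) / 2 + 1) * e) * (u + 1) by ring.
by rewrite mulrA [P * _]mulrC ler_wpM2r //; lra.
Qed.

Lemma negl_j_down y1 : gap_sep b y1 -> null (fun N i _ => pospart (y1 - yN N i) ^+ 2).
Proof.
move=> gs; have [y10 y11 _ _] := gs.
apply: negl_rate => d d0; pose dl := d / 2; exists (6 / dl ^+ 2 + 8) => N N0.
have dl0 : 0 < dl by rewrite divr_gt0.
have h0 : 0 <= mean N (fun i _ => pospart (y1 - yN N i) ^+ 2).
  by rewrite -(av_cst b m0 N 0); apply: av_le => i k _; exact: sqr_ge0.
rewrite ger0_norm //; apply: av_bound_j => k.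
have nN : 0 < N%:R :> R by rewrite ltr0n.
have n1 : 1 / N%:R <= 1 :> R by rewrite ler_pdivrMr // mul1r ler1n.
have n2 : 0 <= 1 / N%:R :> R by rewrite divr_ge0.
have n3 : 0 <= 2 / N%:R :> R by rewrite divr_ge0.
pose f i := pospart (y1 - yN N i).
pose g i := 2 / 3 * yN N i ^+ 2 * f i + 2 / (N%:R * yN N i).
(* The two drift terms are used on either side of y = dl. The two summands make the respective term
   at least f^2 there, with f <= 1 used when y < dl; the part of the final bound that does not decay
   in N is 2 dl = d. *)
pose A := 3 / (2 * dl ^+ 2) + N%:R * dl / 2.
have A0 : 0 <= A by rewrite addr_ge0 // !divr_ge0 // ?mulr_ge0 ?sqr_ge0 // ltW.
have f0 : f 0 = 0.
  by rewrite /f pospart_eq0 // /ysc mulr0 mul0r; lra.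
have fS i : f i.+1 <= f i + 2 / N%:R.
  apply: pospart_inc => //; rewrite /ysc -[i.+1%:R]natr1.
  rewrite le_eqVlt; apply/orP; left; apply/eqP; field; by rewrite gt_eqF.
have fpos i : 0 <= f i by exact: pospart_ge0.
apply: le_trans (@drift R N (fun i => wN N i k) f g (fun i => f i ^+ 2) (2 * A)
  (2 * (2 / N%:R) ^+ 2) (2 / N%:R) _ _ f0 fpos fS n3 _ _ _ _ _) _.
- by move=> i; exact: wt_ge0.
- by rewrite wt_out // /adm; lia.
- by rewrite mulr_ge0.
- move=> i /wt_adm a fi; have [fE y_lt] := pospart_gt0 fi.
  rewrite /g /f fE; apply: drift_j_ratio => //; lra.
- by rewrite f0 expr0n.
- move=> i /wt_adm a.
  have y0 : 0 < yN N i.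
    rewrite -(pmulr_rgt0 _ nN).
    have -> : N%:R * yN N i = N%:R - 2 * i%:R by rewrite /ysc; field; rewrite gt_eqF.
    have := adm_half a; rewrite -(ler_nat R) natrM -natr1; lra.
  have st : f i ^+ 2 <= A * (g i * f i).
    have f1 : f i <= 1.
      rewrite /f /pospart ge_max; lra.
    have t1 : 0 <= 2 / 3 * yN N i ^+ 2 * f i * f i by rewrite !(sqr_ge0, mulr_ge0).
    have t2 : 0 <= 2 / (N%:R * yN N i) * f i by rewrite mulr_ge0 // divr_ge0 // mulr_ge0 // ltW.
    have a1 : 0 <= 3 / (2 * dl ^+ 2) by rewrite divr_ge0 // mulr_ge0 // sqr_ge0.
    have a2 : 0 <= N%:R * dl / 2 by rewrite divr_ge0 // mulr_ge0 // ltW.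
    have -> : A * (g i * f i) = 3 / (2 * dl ^+ 2) * (2 / 3 * yN N i ^+ 2 * f i * f i) +
       N%:R * dl / 2 * (2 / 3 * yN N i ^+ 2 * f i * f i) +
       (3 / (2 * dl ^+ 2) * (2 / (N%:R * yN N i) * f i) + N%:R * dl / 2 * (2 / (N%:R * yN N i) * f i)).
      by rewrite /A /g; ring.
    have p2 := mulr_ge0 a2 t1; have p3 := mulr_ge0 a1 t2.
    have p1 := mulr_ge0 a1 t1; have p4 := mulr_ge0 a2 t2.
    have [dy|yd] := leP dl (yN N i).
      suff : f i ^+ 2 <= 3 / (2 * dl ^+ 2) * (2 / 3 * yN N i ^+ 2 * f i * f i) by lra.
      have -> : 3 / (2 * dl ^+ 2) * (2 / 3 * yN N i ^+ 2 * f i * f i) =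
         (yN N i / dl) ^+ 2 * f i ^+ 2 by field; rewrite gt_eqF.
      rewrite ler_peMl ?sqr_ge0 // exprn_ege1 // ler_pdivlMr // mul1r //.
    suff : f i ^+ 2 <= N%:R * dl / 2 * (2 / (N%:R * yN N i) * f i) by lra.
    have -> : N%:R * dl / 2 * (2 / (N%:R * yN N i) * f i) = (dl / yN N i) * f i.
      by field; rewrite !gt_eqF.
    rewrite expr2 ler_wpM2r //; apply: le_trans f1 _.
    by rewrite ler_pdivlMr // mul1r ltW.
  apply: (@le_trans _ _ ((f i + 2 / N%:R) ^+ 2)).
    by rewrite lerXn2r ?nnegrE ?addr_ge0.
  by have := sqr_ge0 (f i - 2 / N%:R); lra.
- by rewrite mulr_ge0 // sqr_ge0.
apply: ler_wpM2r; first by apply: sumr_ge0 => i _; exact: wt_ge0.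
have -> : 2 * A * (2 / N%:R) + 2 * (2 / N%:R) ^+ 2 = d + 6 / dl ^+ 2 / N%:R + 8 * (1 / N%:R) ^+ 2.
  by rewrite /A /dl; field; rewrite !gt_eqF.
have -> : d + (6 / dl ^+ 2 + 8) / N%:R = d + 6 / dl ^+ 2 / N%:R + 8 * (1 / N%:R) by ring.
by rewrite lerD2l ler_pM2l // expr2 ler_piMr.
Qed.

Theorem concentration (c2 : R) : 0 < c2 ->
  (fun N => mean N (xN N)) @ \oo --> c2 ->
  null (fun N i k => (xN N i k - c2) ^+ 2) /\ null (fun N i k => (mN N k - m0) ^+ 2).
Proof.
move=> c20 xc.
have [y1 gs] := gap_eq_sep b_gt0.
have [y10 y11 _ _] := gs.
(* The value of x at y = y1, m = m0; its sign is not known at this point. *)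
pose x1 := (y1 / 2) ^+ 2 - m0 ^+ 2.
pose K := (1 + `|m0|) ^+ 2.
have K0 : 0 <= K by exact: sqr_ge0.
have mb N i k : (0 < N)%N -> adm N i k -> `|mN N k| <= 1.
  by move=> N0 a; have := msc_bnd R N0 a; have := ysc_bnd R N0 a; rewrite ler_norml; lra.
have nB := negl_x_msc m0 b_gt0.
have n3 : null (fun N i k => xN N i k ^+ 3 * (xN N i k - x1) ^+ 2).
  apply: (@negl_dom _ _ _ _ (fun N i k => 2^-1 * (xN N i k ^+ 3 * (yN N i - y1) ^+ 2) +
      (2 * K) * (xN N i k * (mN N k - m0) ^+ 2))); last first.
    by apply: neglD; apply: neglZ => //; exact: negl_x_ysc.
  move=> N i k N0 a; have /andP[x0 xy] := xsc_bnd R N0 a; have /andP[ya yb] := ysc_bnd R N0 a.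
  have mk := mb N i k N0 a.
  rewrite ger0_norm; last by apply: mulr_ge0; [exact: exprn_ge0|exact: sqr_ge0].
  have -> : xN N i k - x1 = (yN N i + y1) * (yN N i - y1) / 4 - (mN N k + m0) * (mN N k - m0).
    by rewrite /xsc /x1; field.
  move: xy x0 mk; set x := xN N i k; set y := yN N i in ya yb *; set m := mN N k => xy x0 mk.
  have x_1 : x <= 1 by nra.
  have x3 : x ^+ 3 <= x by rewrite exprS ler_piMr // expr_le1.
  have x30 : 0 <= x ^+ 3 by rewrite exprn_ge0.
  have h1 : ((y + y1) * (y - y1) / 4) ^+ 2 <= 4^-1 * (y - y1) ^+ 2.
    rewrite !exprMn mulrAC ler_wpM2r ?sqr_ge0 //.
    have : (y + y1) ^+ 2 <= 2 ^+ 2 by rewrite lerXn2r ?nnegrE //; lra.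
    lra.
  have h2 : ((m + m0) * (m - m0)) ^+ 2 <= K * (m - m0) ^+ 2.
    rewrite exprMn ler_wpM2r ?sqr_ge0 // -real_normK ?num_real // lerXn2r ?nnegrE //.
    by apply: le_trans (ler_normD _ _) _; rewrite lerD2r.
  set p := (y + y1) * _ / 4 in h1 *; set r := (m + m0) * _ in h2 *.
  have h3 : (p - r) ^+ 2 <= 2 * p ^+ 2 + 2 * r ^+ 2 by have := sqr_ge0 (p + r); lra.
  apply: (@le_trans _ _ (x ^+ 3 * (2 * (4^-1 * (y - y1) ^+ 2)) + x ^+ 3 * (2 * (K * (m - m0) ^+ 2)))).
    rewrite -mulrDr ler_wpM2l //; lra.
  apply: lerD; first by lra.
  have -> : 2 * K * (x * (m - m0) ^+ 2) = x * (2 * (K * (m - m0) ^+ 2)) by ring.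
  by rewrite ler_wpM2r // !(sqr_ge0, mulr_ge0).
(* If x1 <= 0 then x <= x - x1, so [n3] makes x^5 negligible, and hence x by x <= d + x (x / d)^4,
   against c2 > 0. *)
have x1_gt0 : 0 < x1.
  rewrite ltNge; apply/negP => x1_le0.
  have nx : null xN.
    apply: negl_eps => d d0; exists (fun N i k => d^-1 ^+ 4 * (xN N i k ^+ 3 * (xN N i k - x1) ^+ 2)).
      exact: neglZ.
    move=> N i k N0 a; have /andP[x0 _] := xsc_bnd R N0 a.
    rewrite ger0_norm //; move: x0; set x := xN N i k => x0.
    have hx : x ^+ 2 <= (x - x1) ^+ 2 by rewrite lerXn2r ?nnegrE //; lra.
    have [xd|dx] := leP x d.
      by rewrite ler_wpDr // !(sqr_ge0, mulr_ge0) ?exprn_ge0 ?invr_ge0 // ltW.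
    apply: ler_wpDl; first exact: ltW.
    apply: (@le_trans _ _ (d^-1 ^+ 4 * (x ^+ 3 * x ^+ 2))); last first.
      by rewrite ler_wpM2l ?exprn_ge0 ?invr_ge0 ?(ltW d0) // ler_wpM2l ?exprn_ge0.
    have -> : d^-1 ^+ 4 * (x ^+ 3 * x ^+ 2) = x * (x / d) ^+ 4 by field; rewrite gt_eqF.
    by rewrite ler_peMr // exprn_ege1 // ler_pdivlMr // mul1r ltW.
  have e : c2 = 0 by exact: (cvg_unique _ xc nx).
  by move: c20; rewrite e ltxx.
(* A one-sided bound without the weight x^3: x can fall below x1 only if y < y1 or |m| > |m0|, and
   drift controls both. *)
have n4 : null (fun N i k => pospart (x1 - xN N i k) ^+ 2).
  apply: (@negl_dom _ _ _ _ (fun N i k => 3 * pospart (y1 - yN N i) ^+ 2 +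
     (3 * K * pospart (mN N k - `|m0|) ^+ 2 + 3 * K * pospart (- mN N k - `|m0|) ^+ 2))); last first.
    apply: neglD; first by apply: neglZ; exact: negl_j_down.
    by apply: neglD; apply: neglZ; [exact: negl_m_up|exact: negl_m_down].
  move=> N i k N0 a; have /andP[ya yb] := ysc_bnd R N0 a.
  have mk := mb N i k N0 a.
  rewrite ger0_norm ?sqr_ge0 //.
  have -> : x1 - xN N i k = (y1 + yN N i) * (y1 - yN N i) / 4 + (mN N k ^+ 2 - m0 ^+ 2).
    by rewrite /xsc /x1; field.
  move: mk; set y := yN N i in ya yb *; set m := mN N k => mk.
  have p1 := pospart_ge0 (y1 - y); have p2 := pospart_ge0 (m - `|m0|).
  have p3 := pospart_ge0 (- m - `|m0|).
  have q1 := pospart_ge (y1 - y); have q2 := pospart_ge (m - `|m0|).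
  have q3 := pospart_ge (- m - `|m0|).
  have h1 : (y1 + y) * (y1 - y) / 4 <= pospart (y1 - y).
    apply: (@le_trans _ _ ((y1 + y) * pospart (y1 - y) / 4)).
      by rewrite ler_pM2r ?invr_gt0 // ler_wpM2l //; lra.
    have : (y1 + y) * pospart (y1 - y) <= 2 * pospart (y1 - y) by rewrite ler_wpM2r //; lra.
    lra.
  have h2 : m ^+ 2 - m0 ^+ 2 <= (1 + `|m0|) * (pospart (m - `|m0|) + pospart (- m - `|m0|)).
    rewrite -[m ^+ 2]real_normK ?num_real // -[m0 ^+ 2]real_normK ?num_real //.
    have -> : `|m| ^+ 2 - `|m0| ^+ 2 = (`|m| + `|m0|) * (`|m| - `|m0|) by ring.
    apply: (@le_trans _ _ ((`|m| + `|m0|) * (pospart (m - `|m0|) + pospart (- m - `|m0|)))).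
      rewrite ler_wpM2l ?addr_ge0 //; case: (ger0P m) => _; lra.
    by rewrite ler_wpM2r ?addr_ge0 // lerD2r.
  set r := pospart (y1 - y) in p1 q1 h1 *; set s := pospart (m - _) in p2 q2 h2 *.
  set t := pospart (- m - _) in p3 q3 h2 *.
  apply: (@le_trans _ _ ((r + (1 + `|m0|) * (s + t)) ^+ 2)).
    rewrite lerXn2r ?nnegrE ?pospart_ge0 //.
      by rewrite addr_ge0 // mulr_ge0 ?addr_ge0.
    by rewrite /pospart ge_max lerD // andbT addr_ge0 // mulr_ge0 ?addr_ge0.
  rewrite /K; move: (1 + `|m0|) => z.
  have := sqr_ge0 (r - z * s); have := sqr_ge0 (r - z * t); have := sqr_ge0 (z * s - z * t); lra.
(* Where x >= x1 / 2 the weight can be divided out of [n3]; elsewhere x < x1 and [n4] applies. *)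
have n5 : null (fun N i k => (xN N i k - x1) ^+ 2).
  apply: (@negl_dom _ _ _ _ (fun N i k => 8 / x1 ^+ 3 * (xN N i k ^+ 3 * (xN N i k - x1) ^+ 2) +
     pospart (x1 - xN N i k) ^+ 2)); last by apply: neglD => //; exact: neglZ.
  move=> N i k N0 a; have /andP[x0 xy] := xsc_bnd R N0 a.
  rewrite ger0_norm ?sqr_ge0 //; set x := xN N i k in x0 xy *.
  have [hx|hx] := leP (x1 / 2) x.
    apply: ler_wpDr; first exact: sqr_ge0.
    rewrite mulrA ler_peMl ?sqr_ge0 //.
    have -> : 8 / x1 ^+ 3 * x ^+ 3 = (2 * x / x1) ^+ 3 by field; rewrite gt_eqF.
    by rewrite exprn_ege1 // ler_pdivlMr // mul1r; lra.
  apply: ler_wpDl; first by rewrite !(sqr_ge0, mulr_ge0) ?invr_ge0 ?exprn_ge0 // ltW.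
  by rewrite -sqrrN opprB /pospart max_r //; lra.
have xx1 : (fun N => mean N (xN N)) @ \oo --> x1.
  have h : null (fun N i k => xN N i k - x1).
    by apply: negl_dom (negl_sqrt n5) => N i k _ _.
  have -> : (fun N => mean N (xN N)) = (fun N => mean N (fun i k => xN N i k - x1) + x1).
    by apply/funext => N; rewrite [in RHS]avB av_cst subrK.
  by have := cvgD h (cvg_cst x1); rewrite add0r; apply.
have e : c2 = x1 by exact: (cvg_unique _ xc xx1).
rewrite e; split=> //.
(* Chebyshev: where x < x1 / 2 the bounded quantity (m - m0)^2 <= K is paid for by 4 (x - x1)^2 /
   x1^2 >= 1. *)
apply: (@negl_dom _ _ _ _ (fun N i k => 2 / x1 * (xN N i k * (mN N k - m0) ^+ 2) +
   4 * K / x1 ^+ 2 * (xN N i k - x1) ^+ 2)); last by apply: neglD; exact: neglZ.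
move=> N i k N0 a; have /andP[x0 xy] := xsc_bnd R N0 a; have mk := mb N i k N0 a.
rewrite ger0_norm ?sqr_ge0 //; set x := xN N i k in x0 xy *.
have [hx|hx] := leP (x1 / 2) x.
  apply: ler_wpDr; first by rewrite !(sqr_ge0, mulr_ge0) ?invr_ge0 ?exprn_ge0 // ltW.
  rewrite mulrA ler_peMl ?sqr_ge0 //.
  by rewrite mulrAC ler_pdivlMr // mul1r; lra.
apply: ler_wpDl; first by rewrite !(sqr_ge0, mulr_ge0) ?invr_ge0 // ltW.
apply: (@le_trans _ _ K).
  rewrite -real_normK ?num_real // lerXn2r ?nnegrE ?addr_ge0 //.
  by apply: le_trans (ler_normB _ _) _; rewrite lerD2r.
have -> : 4 * K / x1 ^+ 2 * (x - x1) ^+ 2 = K * (2 * (x1 - x) / x1) ^+ 2 by field; rewrite gt_eqF.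
by rewrite ler_peMr // exprn_ege1 // ler_pdivlMr // mul1r; lra.
Qed.

End Drift.

(** * Complex limits and the matrix exponential *)

Section ComplexLimits.
Local Open Scope classical_set_scope.
Local Open Scope ring_scope.
Variable R : realType.
Local Notation C := R[i].
Implicit Types (z w : C) (x y : R).

Lemma C_eq z w : reC z = reC w -> imC z = imC w -> z = w.
Proof. by case: z => a b; case: w => c d; rewrite /reC /imC /= => -> ->. Qed.

Lemma reCD z w : reC (z + w) = reC z + reC w. Proof. by case: z; case: w. Qed.
Lemma imCD z w : imC (z + w) = imC z + imC w. Proof. by case: z; case: w. Qed.
Lemma reCM z w : reC (z * w) = reC z * reC w - imC z * imC w. Proof. by case: z; case: w. Qed.
Lemma imCM z w : imC (z * w) = reC z * imC w + imC z * reC w. Proof. by case: z; case: w. Qed.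

Lemma reC_sum I (r : seq I) P (F : I -> C) : reC (\sum_(i <- r | P i) F i) = \sum_(i <- r | P i) reC (F i).
Proof. by apply: (big_morph (@reC R)) => //; exact: reCD. Qed.
Lemma imC_sum I (r : seq I) P (F : I -> C) : imC (\sum_(i <- r | P i) F i) = \sum_(i <- r | P i) imC (F i).
Proof. by apply: (big_morph (@imC R)) => //; exact: imCD. Qed.

Lemma rCD x y : rC (x + y) = rC x + rC y.
Proof. by apply: C_eq; rewrite /reC /imC /= ?addr0. Qed.
Lemma rCM x y : rC (x * y) = rC x * rC y.
Proof. by apply: C_eq; rewrite /reC /imC /= !(mulr0, mul0r) ?subr0 ?addr0. Qed.
Lemma rCN x : rC (- x) = - rC x.
Proof. by apply: C_eq; rewrite /reC /imC /= ?oppr0. Qed.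
Lemma rCX x k : rC (x ^+ k) = rC x ^+ k.
Proof. by elim: k => // k IH; rewrite !exprS rCM IH. Qed.
Lemma rC_sum I (r : seq I) P (F : I -> R) : rC (\sum_(i <- r | P i) F i) = \sum_(i <- r | P i) rC (F i).
Proof. by apply: (big_morph (@rC R)) => //; exact: rCD. Qed.
Lemma rC_nat k : rC k%:R = k%:R :> C.
Proof. by elim: k => // k IH; rewrite -!natr1 rCD IH. Qed.
Lemma rC_inj : injective (@rC R).
Proof. by move=> x y /(congr1 (@reC R)). Qed.
Lemma rC_nat0 : rC 0 = 0 :> C. Proof. by []. Qed.
Lemma rCV x : rC x^-1 = (rC x)^-1.
Proof.
have [->|x0] := eqVneq x 0; first by rewrite invr0 rC_nat0 invr0.
apply: (@mulfI _ (rC x)); first by rewrite -rC_nat0 (inj_eq rC_inj).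
by rewrite -rCM divff // divff // -rC_nat0 (inj_eq rC_inj).
Qed.

Lemma cvgC_cst z : cvgC (fun _ => z) z.
Proof. by split; exact: cvg_cst. Qed.

Lemma cvgCD u v z w : cvgC u z -> cvgC v w -> cvgC (fun N => u N + v N) (z + w).
Proof.
move=> [ur ui] [vr vi]; split.
  by rewrite reCD; under eq_fun do rewrite reCD; exact: cvgD.
by rewrite imCD; under eq_fun do rewrite imCD; exact: cvgD.
Qed.

Lemma cvgCM u v z w : cvgC u z -> cvgC v w -> cvgC (fun N => u N * v N) (z * w).
Proof.
move=> [ur ui] [vr vi]; split.
  by rewrite reCM; under eq_fun do rewrite reCM; apply: cvgB; exact: cvgM.
by rewrite imCM; under eq_fun do rewrite imCM; apply: cvgD; exact: cvgM.
Qed.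

Lemma cvgC_sum (I : finType) (u : I -> nat -> C) (z : I -> C) :
  (forall i, cvgC (u i) (z i)) -> cvgC (fun N => \sum_i u i N) (\sum_i z i).
Proof.
move=> h; elim: (index_enum I) => [|i s IH].
  rewrite big_nil; under eq_fun do rewrite big_nil; exact: cvgC_cst.
rewrite big_cons; under eq_fun do rewrite big_cons; exact: cvgCD.
Qed.

Lemma cvgC_unique u z w : cvgC u z -> cvgC u w -> z = w.
Proof.
move=> [ur ui] [vr vi]; apply: C_eq; first exact: (cvg_unique _ ur vr).
exact: (cvg_unique _ ui vi).
Qed.

(** A submultiplicative norm with values in R, where the dominating exponential series lives. *)
Definition norm1 z : R := `|reC z| + `|imC z|.

Lemma norm1D z w : norm1 (z + w) <= norm1 z + norm1 w.
Proof.
rewrite /norm1 reCD imCD addrACA; apply: lerD; exact: ler_normD.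
Qed.

Lemma norm1M z w : norm1 (z * w) <= norm1 z * norm1 w.
Proof.
rewrite /norm1 reCM imCM mulrDl !mulrDr.
apply: le_trans (lerD (ler_normB _ _) (ler_normD _ _)) _; rewrite !normrM; lra.
Qed.

Lemma norm1_ge0 z : 0 <= norm1 z.
Proof. by rewrite addr_ge0. Qed.

Lemma norm1_sum I (r : seq I) P (F : I -> C) :
  norm1 (\sum_(i <- r | P i) F i) <= \sum_(i <- r | P i) norm1 (F i).
Proof.
elim/big_rec2: _ => [|i x y _ h]; first by rewrite /norm1 normr0 addr0.
by apply: le_trans (norm1D _ _) _; rewrite lerD2l.
Qed.

Section Expm.
Variables (n : nat) (A : 'M[C]_n).

Definition expm_psum K : 'M[C]_n := \sum_(k < K) (rC (k`!%:R)^-1) *: A ^+ k.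

Definition mx_bound : R := \sum_i \sum_j norm1 (A i j).

Lemma norm1_mxpow k i j : norm1 ((A ^+ k) i j) <= mx_bound ^+ k.
Proof.
have rowb i' : \sum_j norm1 (A i' j) <= mx_bound.
  rewrite /mx_bound [X in _ <= X](bigD1 i') //= lerDl.
  by apply: sumr_ge0 => l _; apply: sumr_ge0 => q _; exact: norm1_ge0.
have b0 : 0 <= mx_bound.
  by apply: sumr_ge0 => l _; apply: sumr_ge0 => q _; exact: norm1_ge0.
elim: k i j => [|k IH] i j.
  rewrite !expr0 mxE; case: eqP => _; rewrite /norm1 /reC /imC /= normr0 addr0 ?normr1 ?normr0 //.
rewrite exprS mxE; apply: le_trans (norm1_sum _ _ _) _.
apply: (@le_trans _ _ (\sum_l norm1 (A i l) * mx_bound ^+ k)).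
  apply: ler_sum => l _; apply: le_trans (norm1M _ _) _.
  by rewrite ler_wpM2l ?norm1_ge0.
by rewrite -mulr_suml exprS ler_wpM2r // exprn_ge0.
Qed.

Lemma series_dominated_cvg (u : nat -> R) :
  (forall k, `|u k| <= mx_bound ^+ k) -> cvgn (fun K => \sum_(k < K) k`!%:R^-1 * u k).
Proof.
move=> h.
have -> : (fun K => \sum_(k < K) k`!%:R^-1 * u k) = series (fun k => k`!%:R^-1 * u k).
  by apply/funext => K; rewrite /series /= big_mkord.
apply: normed_cvg; apply: (@series_le_cvg _ _ (exp_coeff mx_bound)).
- by move=> k; exact: normr_ge0.
- by move=> k; rewrite /exp_coeff /= (le_trans _ (ler_wpM2r _ (h k))) // ?mulr_ge0 // ?invr_ge0.
- move=> k /=; rewrite normrM ger0_norm ?invr_ge0 // mulrC /exp_coeff /=.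
  by rewrite ler_wpM2r // invr_ge0.
- exact: is_cvg_series_exp_coeff.
Qed.

Lemma expm_psumE K i j : expm_psum K i j = \sum_(k < K) rC (k`!%:R)^-1 * (A ^+ k) i j.
Proof. by rewrite summxE; apply: eq_bigr => k _; rewrite mxE. Qed.

(** [expm] is built from [limn], which is informative only for convergent sequences; every entry is
    dominated by the exponential series of [mx_bound]. *)
Lemma expm_cvg i j : cvgC (fun K => expm_psum K i j) (expm A i j).
Proof.
have hre k : `|reC ((A ^+ k) i j)| <= mx_bound ^+ k.
  by apply: le_trans (norm1_mxpow k i j); rewrite lerDl.
have him k : `|imC ((A ^+ k) i j)| <= mx_bound ^+ k.
  by apply: le_trans (norm1_mxpow k i j); rewrite lerDr.
rewrite /expm mxE; split.
  have := series_dominated_cvg hre.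
  have e : (fun K => reC (expm_psum K i j)) = (fun K => \sum_(k < K) k`!%:R^-1 * reC ((A ^+ k) i j)).
    apply/funext => K; rewrite expm_psumE reC_sum; apply: eq_bigr => k _.
    by rewrite reCM [imC (rC _)]/(0) mul0r subr0.
  rewrite -e; exact.
have := series_dominated_cvg him.
have e : (fun K => imC (expm_psum K i j)) = (fun K => \sum_(k < K) k`!%:R^-1 * imC ((A ^+ k) i j)).
  apply/funext => K; rewrite expm_psumE imC_sum; apply: eq_bigr => k _.
  by rewrite imCM [imC (rC _)]/(0) mul0r addr0.
by rewrite -e; exact.
Qed.

Lemma mxpow_eigen (v : 'cV[C]_n) z k : A *m v = z *: v -> A ^+ k *m v = z ^+ k *: v.
Proof.
move=> h; elim: k => [|k IH]; first by rewrite !expr0 mul1mx scale1r.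
by rewrite exprSr -mulmxE -mulmxA h -scalemxAr IH scalerA exprS.
Qed.

Lemma expm_eigen (v : 'cV[C]_n) z w : A *m v = z *: v ->
  cvgC (fun K => \sum_(k < K) rC (k`!%:R)^-1 * z ^+ k) w -> expm A *m v = w *: v.
Proof.
move=> h zw; apply/colP => i; rewrite [LHS]mxE [RHS]mxE.
apply: (@cvgC_unique (fun K => \sum_j expm_psum K i j * v j 0)).
  by apply: cvgC_sum => j; apply: cvgCM; [exact: expm_cvg|exact: cvgC_cst].
have -> : (fun K => \sum_j expm_psum K i j * v j 0) =
   (fun K => (\sum_(k < K) rC (k`!%:R)^-1 * z ^+ k) * v i 0).
  apply/funext => K; transitivity ((expm_psum K *m v) i 0); first by rewrite mxE.
  rewrite /expm_psum mulmx_suml summxE mulr_suml; apply: eq_bigr => k _.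
  by rewrite -scalemxAl (mxpow_eigen k h) scalerA mxE.
by apply: cvgCM => //; exact: cvgC_cst.
Qed.
End Expm.

Lemma expm_eigen_real n (A : 'M[C]_n) (v : 'cV[C]_n) x :
  A *m v = rC x *: v -> expm A *m v = rC (expR x) *: v.
Proof.
move=> h; apply: expm_eigen h _.
have -> : (fun K => \sum_(k < K) rC (k`!%:R)^-1 * rC x ^+ k) = (fun K => rC (series (exp_coeff x) K)).
  apply/funext => K; rewrite /series /= big_mkord rC_sum; apply: eq_bigr => k _.
  by rewrite -rCX -rCM mulrC.
split => /=; last exact: cvg_cst.
exact: is_cvg_series_exp_coeff.
Qed.

(** The components have the shape of the terms of [cos_coeff] and [sin_coeff], so that the partial
    sums match literally. *)
Lemma expr_imaginary y k : (Complex 0 y : C) ^+ k =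
  Complex ((~~ odd k)%:R * (-1) ^ k./2 * y ^+ k) ((odd k)%:R * (-1) ^+ k.-1./2 * y ^+ k).
Proof.
elim: k => [|k IH]; first by apply: C_eq; rewrite /reC /imC /= ?expr0z ?mul1r ?mul0r ?expr0.
rewrite exprS IH.
have e1 : ((-1) ^ k.+1./2 : R) = (-1) ^+ k.+1./2 by [].
have e2 : ((-1) ^ k./2 : R) = (-1) ^+ k./2 by [].
rewrite e1 e2 /= uphalf_half.
case: (boolP (odd k)) => ok /=; apply: C_eq; rewrite /reC /imC /= !(mul0r, mulr0, mul1r) ?subr0 ?addr0 ?add0r ?sub0r //.
  have -> : k.-1./2 = k./2 by move: ok; case: (k) => [|l] //= ol; rewrite uphalf_half (negbTE ol).
  by rewrite add1n exprS exprS; ring.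
by rewrite exprS; ring.
Qed.

Lemma expm_eigen_imaginary n (A : 'M[C]_n) (v : 'cV[C]_n) y :
  A *m v = Complex 0 y *: v -> expm A *m v = Complex (cos y) (sin y) *: v.
Proof.
move=> h; apply: expm_eigen h _.
have e K : \sum_(k < K) rC (k`!%:R)^-1 * (Complex 0 y : C) ^+ k =
   Complex (series (cos_coeff y) K) (series (sin_coeff y) K).
  apply: C_eq.
    rewrite reC_sum /reC /= /series /= big_mkord; apply: eq_bigr => k _.
    by rewrite expr_imaginary /= mul0r subr0 mulrC.
  rewrite imC_sum /imC /= /series /= big_mkord; apply: eq_bigr => k _.
  by rewrite expr_imaginary /= mul0r addr0 mulrC.
split => /=; under eq_fun do rewrite e.
  rewrite /reC /= unlock; exact: is_cvg_series_cos_coeff.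
rewrite /imC /= unlock; exact: is_cvg_series_sin_coeff.
Qed.
End ComplexLimits.

(** * Spin operators *)

Section SpinAlgebra.
Variable R : realType.
Local Notation C := R[i].
Variable N : nat.
Implicit Types (s : cfg N) (k l : 'I_N) (a b c : bool) (p q r : bool -> bool -> C).

Definition upd k b s : cfg N := [ffun j => if j == k then b else s j].

Lemma upd_at k b s : upd k b s k = b. Proof. by rewrite ffunE eqxx. Qed.
Lemma upd_ne k l b s : l != k -> upd k b s l = s l. Proof. by rewrite ffunE => /negbTE ->. Qed.
Lemma upd_id k s : upd k (s k) s = s.
Proof. by apply/ffunP => j; rewrite ffunE; case: eqP => [->|]. Qed.
Lemma upd_same k b c s : upd k c (upd k b s) = upd k c s.
Proof. by apply/ffunP => j; rewrite !ffunE; case: eqP. Qed.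
Lemma upd_comm k l b c s : k != l -> upd l c (upd k b s) = upd k b (upd l c s).
Proof.
move=> kl; apply/ffunP => j; rewrite !ffunE; case: eqP => [->|//].
by rewrite eq_sym (negbTE kl).
Qed.

(** Row s is supported on configurations that agree with s off site k. Products of site operators
    can then be compared through their action on a test matrix. *)
Lemma sigma_mul p k m (V : 'M[C]_(#|cfg N|, m)) i j :
  (sigma_at p k *m V) i j =
  \sum_(b : bool) p (enum_val i k) b * V (enum_rank (upd k b (enum_val i))) j.
Proof.
rewrite mxE; set s := enum_val i.
rewrite (reindex (@enum_rank (cfg N))) /=; last exact/onW_bij/enum_rank_bij.
rewrite (partition_big (fun s' : cfg N => s' k) xpredT) //=; apply: eq_bigr => b _.
rewrite (bigD1 (upd k b s)) ?upd_at //= big1 ?addr0.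
  rewrite mxE enum_rankK upd_at -/s ifT ?mulr1 //.
  by apply/forallP => l; apply/implyP => lk; rewrite upd_ne.
move=> s' /andP[/eqP s'k ne]; rewrite mxE enum_rankK -/s ifF ?mulr0 ?mul0r //.
apply/negbTE; apply: contra ne => /forallP h; apply/eqP/ffunP => l.
rewrite ffunE; case: eqVneq => [->//|lk].
by have := h l; rewrite lk => /eqP.
Qed.

Lemma mx_ext m (A B : 'M[C]_m) : (forall V : 'M[C]_m, A *m V = B *m V) -> A = B.
Proof. by move=> h; rewrite -[A]mulmx1 -[B]mulmx1. Qed.

Definition pauli_comp p q a c : C := \sum_(b : bool) p a b * q b c.

Lemma sigma_same p q k : sigma_at p k *m sigma_at q k = sigma_at (pauli_comp p q) k.
Proof.
apply: mx_ext => V; rewrite -mulmxA; apply/matrixP => i j; rewrite !sigma_mul.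
under eq_bigr => b _ do rewrite sigma_mul enum_rankK upd_at mulr_sumr.
rewrite exchange_big /=; apply: eq_bigr => c _; rewrite /pauli_comp mulr_suml.
by apply: eq_bigr => b _; rewrite upd_same mulrA.
Qed.

Lemma sigma_commute p q k l : k != l ->
  sigma_at p k *m sigma_at q l = sigma_at q l *m sigma_at p k.
Proof.
move=> kl; apply: mx_ext => V; rewrite -!mulmxA; apply/matrixP => i j; rewrite !sigma_mul.
under eq_bigr => b _ do rewrite sigma_mul enum_rankK upd_ne 1?eq_sym // mulr_sumr.
rewrite exchange_big /=; apply: eq_bigr => c _.
rewrite sigma_mul enum_rankK upd_ne // mulr_sumr; apply: eq_bigr => b _.
by rewrite mulrCA upd_comm.
Qed.

(** Distinct sites commute, so only the diagonal terms remain. The 2 in the hypothesis balances the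
    factor 1/2 of [Stot], which occurs twice on the left and once on the right. *)
Lemma Stot_comm p q r (w : C) :
  (forall a c, pauli_comp p q a c - pauli_comp q p a c = 2 * w * r a c) ->
  Stot N p *m Stot N q - Stot N q *m Stot N p = w *: Stot N r.
Proof.
move=> h.
have sub k : sigma_at (pauli_comp p q) k - sigma_at (pauli_comp q p) k = (2 * w) *: sigma_at r k.
  by apply/matrixP => i j; rewrite !mxE -mulrBl h mulrA.
rewrite /Stot -!scalemxAl -!scalemxAr !scalerA -scalerBr.
have -> : (\sum_(k < N) sigma_at p k) *m (\sum_(k < N) sigma_at q k) -
   (\sum_(k < N) sigma_at q k) *m (\sum_(k < N) sigma_at p k) = \sum_(k < N) (2 * w) *: sigma_at r k.
  rewrite mulmx_suml.
  have -> : (\sum_(k < N) sigma_at q k) *m (\sum_(k < N) sigma_at p k) =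
     \sum_(k < N) (\sum_(l < N) sigma_at q l) *m sigma_at p k by rewrite mulmx_sumr.
  rewrite -sumrB; apply: eq_bigr => k _.
  rewrite mulmx_sumr mulmx_suml -sumrB (bigD1 k) //= big1 ?addr0 ?sigma_same //.
  by move=> l lk; rewrite sigma_commute ?subrr // eq_sym.
rewrite -scaler_sumr !scalerA; congr (_ *: _).
apply: C_eq; rewrite !(reCM, imCM) /rC /reC /imC /=; case: w {h sub} => x y /=; by field.
Qed.

Lemma iCiC : iC R * iC R = -1.
Proof. by apply: C_eq; rewrite /reC /imC /= !(mul0r, mulr0, mulr1) ?sub0r ?addr0 ?oppr0. Qed.

Ltac pauli_tac := move=> [] []; rewrite /pauli_comp !big_bool /= /pauli_x /pauli_y /pauli_z /=;
  apply: C_eq; rewrite /reC /imC /=; ring.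

Lemma Sxy : Sx R N *m Sy R N - Sy R N *m Sx R N = iC R *: Sz R N.
Proof. apply: Stot_comm; pauli_tac. Qed.
Lemma Syz : Sy R N *m Sz R N - Sz R N *m Sy R N = iC R *: Sx R N.
Proof. apply: Stot_comm; pauli_tac. Qed.
Lemma Szx : Sz R N *m Sx R N - Sx R N *m Sz R N = iC R *: Sy R N.
Proof. apply: Stot_comm; pauli_tac. Qed.

Section Ladder.
Variables (n : nat) (X Y Z : 'M[C]_n).

Lemma ladder_PM : X *m Y - Y *m X = iC R *: Z ->
  (X + iC R *: Y) *m (X - iC R *: Y) = X *m X + Y *m Y + Z.
Proof.
rewrite mulmxDl !mulmxBr -!scalemxAl -!scalemxAr scalerA iCiC.
(* Once the products are opaque matrices, the claim is linear in their entries and commutative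
   [ring] applies entrywise. *)
move: (X *m X) (Y *m Y) (X *m Y) (Y *m X).
move=> XX YY XY YX /matrixP h; apply/matrixP => i j; have := h i j; rewrite !mxE => e.
have -> : XY i j = YX i j + iC R * Z i j by rewrite -e; ring.
by rewrite mulrDr mulrA iCiC; ring.
Qed.

Lemma ladder_MP : X *m Y - Y *m X = iC R *: Z ->
  (X - iC R *: Y) *m (X + iC R *: Y) = X *m X + Y *m Y - Z.
Proof.
rewrite mulmxBl !mulmxDr -!scalemxAl -!scalemxAr scalerA iCiC.
move: (X *m X) (Y *m Y) (X *m Y) (Y *m X).
move=> XX YY XY YX /matrixP h; apply/matrixP => i j; have := h i j; rewrite !mxE => e.
have -> : XY i j = YX i j + iC R * Z i j by rewrite -e; ring.
by rewrite mulrDr mulrA iCiC; ring.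
Qed.

Hypothesis YZ : Y *m Z - Z *m Y = iC R *: X.
Hypothesis ZX : Z *m X - X *m Z = iC R *: Y.

Lemma ladder_ZP : Z *m (X + iC R *: Y) = (X + iC R *: Y) *m Z + (X + iC R *: Y).
Proof.
rewrite mulmxDr mulmxDl -!scalemxAl -!scalemxAr; move: YZ ZX.
move: (Z *m X) (X *m Z) (Y *m Z) (Z *m Y) => A B D E /matrixP h /matrixP g.
apply/matrixP => i j; have := h i j; have := g i j; rewrite !mxE => e1 e2.
have -> : A i j = B i j + iC R * Y i j by rewrite -e1; ring.
have -> : D i j = E i j + iC R * X i j by rewrite -e2; ring.
by rewrite mulrDr mulrA iCiC; ring.
Qed.

Lemma ladder_ZM : Z *m (X - iC R *: Y) = (X - iC R *: Y) *m Z - (X - iC R *: Y).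
Proof.
rewrite mulmxBr mulmxBl -!scalemxAl -!scalemxAr; move: YZ ZX.
move: (Z *m X) (X *m Z) (Y *m Z) (Z *m Y) => A B D E /matrixP h /matrixP g.
apply/matrixP => i j; have := h i j; have := g i j; rewrite !mxE => e1 e2.
have -> : A i j = B i j + iC R * Y i j by rewrite -e1; ring.
have -> : D i j = E i j + iC R * X i j by rewrite -e2; ring.
by rewrite mulrDr mulrA iCiC; ring.
Qed.
End Ladder.

Lemma SplusSminus : Splus R N *m Sminus R N = S2 R N - Sz R N *m Sz R N + Sz R N.
Proof. by rewrite /S2 addrK; exact: ladder_PM Sxy. Qed.

Lemma SminusSplus : Sminus R N *m Splus R N = S2 R N - Sz R N *m Sz R N - Sz R N.
Proof. by rewrite /S2 addrK; exact: ladder_MP Sxy. Qed.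

Lemma SzSplus : Sz R N *m Splus R N = Splus R N *m Sz R N + Splus R N.
Proof. exact: ladder_ZP Syz Szx. Qed.

Lemma SzSminus : Sz R N *m Sminus R N = Sminus R N *m Sz R N - Sminus R N.
Proof. exact: ladder_ZM Syz Szx. Qed.

(** The zero vector is allowed, so the ladder operators preserve this relation even at the ends of a
    multiplet. *)
Definition jeig (lam M : R) (v : 'cV[C]_#|cfg N|) :=
  S2 R N *m v = rC lam *: v /\ Sz R N *m v = rC M *: v.

Lemma jeig_PM lam M v : jeig lam M v ->
  Splus R N *m (Sminus R N *m v) = rC (lam - M ^+ 2 + M) *: v.
Proof.
move=> [h2 hz]; rewrite mulmxA SplusSminus mulmxDl mulmxBl -mulmxA h2 !hz -scalemxAr hz.
by rewrite scalerA -scalerBl -scalerDl -rCM -rCN -!rCD expr2.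
Qed.

Lemma jeig_MP lam M v : jeig lam M v ->
  Sminus R N *m (Splus R N *m v) = rC (lam - M ^+ 2 - M) *: v.
Proof.
move=> [h2 hz]; rewrite mulmxA SminusSplus !mulmxBl -mulmxA h2 !hz -scalemxAr hz.
by rewrite scalerA -!scalerBl -rCM -!rCN -!rCD expr2.
Qed.

Lemma jeig_P lam M v : jeig lam M v -> jeig lam (M + 1) (Splus R N *m v).
Proof.
move=> j; have [h2 hz] := j.
have z : Sz R N *m (Splus R N *m v) = rC (M + 1) *: (Splus R N *m v).
  by rewrite mulmxA SzSplus mulmxDl -mulmxA hz -scalemxAr rCD scalerDl scale1r.
split => //.
(* In this form S^2 acts on S_+ v through S_+ (S_- S_+ v), a scalar multiple of S_+ v by
   [jeig_MP]. *)
have -> : S2 R N = Splus R N *m Sminus R N + Sz R N *m Sz R N - Sz R N.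
  by rewrite SplusSminus; move: (S2 R N) (Sz R N *m Sz R N) (Sz R N) => A B D; rewrite addrAC addrK subrK.
rewrite mulmxBl mulmxDl -[(Splus R N *m Sminus R N) *m _]mulmxA (jeig_MP j).
rewrite -[(Sz R N *m Sz R N) *m _]mulmxA z -!scalemxAr z scalerA.
rewrite -scalerDl -scalerBl -rCM -rCN -!rCD; congr (rC _ *: _); ring.
Qed.

Lemma jeig_M lam M v : jeig lam M v -> jeig lam (M - 1) (Sminus R N *m v).
Proof.
move=> j; have [h2 hz] := j.
have z : Sz R N *m (Sminus R N *m v) = rC (M - 1) *: (Sminus R N *m v).
  by rewrite mulmxA SzSminus mulmxBl -mulmxA hz -scalemxAr rCD rCN scalerDl scaleNr scale1r.
split => //.
have -> : S2 R N = Sminus R N *m Splus R N + Sz R N *m Sz R N + Sz R N.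
  by rewrite SminusSplus; move: (S2 R N) (Sz R N *m Sz R N) (Sz R N) => A B D; apply/matrixP => x y; rewrite !mxE; ring.
rewrite mulmxDl mulmxDl -[(Sminus R N *m Splus R N) *m _]mulmxA (jeig_PM j).
rewrite -[(Sz R N *m Sz R N) *m _]mulmxA z -!scalemxAr z scalerA.
rewrite -!scalerDl -rCM -!rCD; congr (rC _ *: _); ring.
Qed.

Definition ups s : nat := \sum_k s k.

Lemma Sz_mul m (V : 'M[C]_(#|cfg N|, m)) i j :
  (Sz R N *m V) i j = rC ((ups (enum_val i))%:R - N%:R / 2) * V i j.
Proof.
rewrite /Sz /Stot -scalemxAl mxE mulmx_suml summxE.
under eq_bigr => k _.
  rewrite sigma_mul.
  have -> : \sum_b pauli_z R (enum_val i k) b * V (enum_rank (upd k b (enum_val i))) j =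
     rC (2 * (enum_val i k)%:R - 1) * V i j.
    rewrite (bigD1 (enum_val i k)) //= big1 ?addr0 => [|b ne]; last first.
      by rewrite /pauli_z eq_sym (negbTE ne) mul0r.
    rewrite upd_id enum_valK /pauli_z eqxx; congr (_ * _).
    by case: (enum_val i k); apply: C_eq; rewrite /reC /imC /= ?oppr0 //; lra.
  over.
rewrite -mulr_suml mulrA -rC_sum -rCM; congr (rC _ * _).
rewrite sumrB -mulr_sumr sumr_const card_ord /ups natr_sum; by field.
Qed.

Lemma adj_mul m n (n' : nat) (A : 'M[C]_(m, n)) (B : 'M[C]_(n, n')) : adj (A *m B) = adj B *m adj A.
Proof. by rewrite /adj map_mxM trmx_mul. Qed.

Lemma adj_invol m n (A : 'M[C]_(m, n)) : adj (adj A) = A.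
Proof. by apply/matrixP => i j; rewrite !mxE conjCK. Qed.

Lemma adj_sigma p k : (forall a b, Num.conj (p b a) = p a b) -> adj (sigma_at p k) = sigma_at p k.
Proof.
move=> h; apply/matrixP => i j; rewrite !mxE rmorphM /= h; congr (_ * _).
have -> : [forall l, (l != k) ==> (enum_val j l == enum_val i l)] =
   [forall l, (l != k) ==> (enum_val i l == enum_val j l)].
  by apply: eq_forallb => l; rewrite [enum_val j l == _]eq_sym.
by case: ifP => _; rewrite ?rmorph1 ?rmorph0.
Qed.

Lemma conjC_E (z : C) : Num.conj z = Complex (reC z) (- imC z).
Proof. by case: z. Qed.

Lemma adj_add m n (A B : 'M[C]_(m, n)) : adj (A + B) = adj A + adj B.
Proof. by apply/matrixP => i j; rewrite !mxE rmorphD. Qed.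

Lemma adj_scale m n (w : C) (A : 'M[C]_(m, n)) : adj (w *: A) = Num.conj w *: adj A.
Proof. by apply/matrixP => i j; rewrite !mxE rmorphM. Qed.

Lemma adj_Stot p : (forall a b, Num.conj (p b a) = p a b) -> adj (Stot N p) = Stot N p.
Proof.
move=> h; rewrite /Stot adj_scale; congr (_ *: _); first by rewrite conjC_E /rC /reC /imC /= oppr0.
apply: (big_ind (fun A => adj A = A)) => [|A B hA hB|k _].
- by apply/matrixP => i j; rewrite !mxE rmorph0.
- by rewrite adj_add hA hB.
- exact: adj_sigma.
Qed.

Lemma adj_Splus : adj (Splus R N) = Sminus R N.
Proof.
rewrite /Splus adj_add adj_scale /Sx /Sy !adj_Stot.
- rewrite /Sminus -scaleNr; congr (_ + _ *: _).
  by rewrite conjC_E /iC /reC /imC; apply: C_eq; rewrite /reC /imC /= ?oppr0.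
- by move=> [] []; rewrite conjC_E /pauli_y /=; apply: C_eq; rewrite /reC /imC /= ?oppr0 ?opprK.
- by move=> [] []; rewrite conjC_E /pauli_x /=; apply: C_eq; rewrite /reC /imC /= ?oppr0 ?opprK.
Qed.

Lemma adj_Sminus : adj (Sminus R N) = Splus R N.
Proof. by rewrite -adj_Splus adj_invol. Qed.

End SpinAlgebra.

(** * Multiplicities of joint eigenvalues *)

Section InnerProduct.
Variable R : realType.
Local Notation C := R[i].

Definition ip n (u v : 'cV[C]_n) : C := (adj u *m v) 0 0.
Definition sqn (z : C) : R := reC z ^+ 2 + imC z ^+ 2.

Lemma sqn0 : sqn 0 = 0.
Proof. by rewrite /sqn /reC /imC /= expr0n addr0. Qed.

Lemma conj_mul_sqn (z : C) : Num.conj z * z = rC (sqn z).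
Proof. by rewrite conjC_E; case: z => x y; apply: C_eq; rewrite /sqn /reC /imC /=; ring. Qed.

Lemma ip_conj n (u v : 'cV[C]_n) : Num.conj (ip u v) = ip v u.
Proof.
rewrite /ip -[adj u *m v]adj_invol adj_mul adj_invol; set A := adj v *m u.
by rewrite /adj 2!mxE conjCK.
Qed.

Lemma ipZr n (u v : 'cV[C]_n) z : ip u (z *: v) = z * ip u v.
Proof. by rewrite /ip -scalemxAr mxE. Qed.

Lemma ipZl n (u v : 'cV[C]_n) z : ip (z *: u) v = Num.conj z * ip u v.
Proof. by rewrite /ip adj_scale -scalemxAl mxE. Qed.

Lemma ip_adj n (A : 'M[C]_n) (u v : 'cV[C]_n) : ip u (A *m v) = ip (adj A *m u) v.
Proof. by rewrite /ip adj_mul adj_invol mulmxA. Qed.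

Lemma rC_sqn_ip n (u : 'cV[C]_n) : ip u u = rC (\sum_i sqn (u i 0)).
Proof. by rewrite /ip mxE rC_sum; apply: eq_bigr => i _; rewrite !mxE conj_mul_sqn. Qed.

(** c is a coupling with marginals x and y, supported on pairs where f and g agree. It is what
    allows sums over different index sets to be compared without a bijection. *)
Lemma sum_transport (I J : finType) (c : I -> J -> R) (x f : I -> R) (y g : J -> R) :
  (forall a, \sum_b c a b = x a) -> (forall b, \sum_a c a b = y b) ->
  (forall a b, c a b != 0 -> f a = g b) -> \sum_a x a * f a = \sum_b y b * g b.
Proof.
move=> cx cy fg.
transitivity (\sum_a \sum_b c a b * f a); first by apply: eq_bigr => a _; rewrite -mulr_suml cx.
rewrite exchange_big /=; apply: eq_bigr => b _; rewrite -cy mulr_suml; apply: eq_bigr => a _.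
by have [->|/fg ->//] := eqVneq (c a b) 0; rewrite !mul0r.
Qed.

Section Orthonormal.
Variables (n : nat) (e : 'I_n -> 'cV[C]_n).
Hypothesis he : forall a b, adj (e a) *m e b = (a == b)%:R%:M.

Lemma ip_basis a b : ip (e a) (e b) = (a == b)%:R.
Proof. by rewrite /ip he mxE eqxx mulr1n. Qed.

Lemma basis_resolution : \sum_a e a *m adj (e a) = 1%:M.
Proof.
pose P : 'M[C]_n := \matrix_(i, a) e a i 0.
have PP : adj P *m P = 1%:M.
  apply/matrixP => a b; rewrite [RHS]mxE -ip_basis /ip !mxE; apply: eq_bigr => i _.
  by rewrite !mxE.
rewrite -(mulmx1C PP); apply/matrixP => i j; rewrite summxE mxE; apply: eq_bigr => a _.
by rewrite !mxE big_ord1 !mxE.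
Qed.

Lemma parseval u v : \sum_b ip u (e b) * ip (e b) v = ip u v.
Proof.
rewrite /ip -[v in RHS]mul1mx -basis_resolution mulmx_suml mulmx_sumr summxE.
apply: eq_bigr => b _; rewrite -mulmxA mulmxA [RHS]mxE big_ord1 //.
Qed.

Lemma parseval_sqn u : \sum_b rC (sqn (ip (e b) u)) = ip u u.
Proof. by rewrite -(parseval u u); apply: eq_bigr => b _; rewrite -conj_mul_sqn ip_conj. Qed.

Lemma trace_basis (A : 'M[C]_n) : \tr A = \sum_a ip (e a) (A *m e a).
Proof.
rewrite -[A in LHS]mulmx1 -basis_resolution mulmx_sumr raddf_sum /=; apply: eq_bigr => a _.
by rewrite mulmxA mxtrace_mulC /ip /mxtrace big_ord1.
Qed.
End Orthonormal.
End InnerProduct.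

Section Labels.
Variables (R : realType) (N : nat).
Local Notation C := R[i].

Lemma adj_Sz : adj (Sz R N) = Sz R N.
Proof.
by apply: adj_Stot => [] [] []; rewrite conjC_E /pauli_z /=; apply: C_eq; rewrite /reC /imC /= ?oppr0 ?opprK.
Qed.

Lemma adj_S2 : adj (S2 R N) = S2 R N.
Proof.
have ax : adj (Sx R N) = Sx R N.
  by apply: adj_Stot => [] [] []; rewrite conjC_E /pauli_x /=; apply: C_eq; rewrite /reC /imC /= ?oppr0 ?opprK.
have ay : adj (Sy R N) = Sy R N.
  by apply: adj_Stot => [] [] []; rewrite conjC_E /pauli_y /=; apply: C_eq; rewrite /reC /imC /= ?oppr0 ?opprK.
by rewrite /S2 !adj_add !adj_mul ax ay adj_Sz.
Qed.

Lemma hermitian_orthogonal n (A : 'M[C]_n) (x y : R) u v : adj A = A ->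
  A *m u = rC x *: u -> A *m v = rC y *: v -> ip u v != 0 -> x = y.
Proof.
move=> hA hu hv uv; have := ip_adj A u v; rewrite hA hu hv ipZr ipZl => h.
have {h} : rC y = Num.conj (rC x) by apply: (mulIf uv).
by rewrite conjC_E => /(congr1 (@reC R)).
Qed.

Lemma ups_le (s : cfg N) : (ups s <= N)%N.
Proof.
rewrite /ups -[X in (_ <= X)%N](card_ord N) -sum1_card; apply: leq_sum => k _.
by case: (s k).
Qed.

(** S_z is diagonal on configurations, so its eigenvalue can be read off at a nonzero coordinate of
    v; the eigenvalue of S^2 is real by hermiticity. *)
Lemma label_exists (v : 'cV[C]_#|cfg N|) (l2 l3 : C) : ip v v = 1 ->
  S2 R N *m v = l2 *: v -> Sz R N *m v = l3 *: v ->
  exists p : R * nat, (p.2 <= N)%N /\ jeig p.1 (spinM R N p.2) v.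
Proof.
move=> v1 h2 h3.
have [i vi] : exists i, v i 0 != 0.
  apply/existsP; rewrite -[X in is_true X]negbK negb_exists; apply/negP => /forallP h.
  have : ip v v = 0.
    rewrite rC_sqn_ip big1 // => i _; have := h i; rewrite negbK => /eqP ->; exact: sqn0.
  by rewrite v1 => /eqP; rewrite oner_eq0.
have l2E : l2 = rC (reC l2).
  have := ip_adj (S2 R N) v v; rewrite adj_S2 h2 ipZr ipZl v1 !mulr1 conjC_E.
  move=> /(congr1 (@imC R)); rewrite /imC /= => h.
  have h0 : imC l2 = 0 by rewrite /imC; lra.
  by apply: C_eq.
exists (reC l2, ups (enum_val i)); split; first exact: ups_le.
split; first by rewrite h2 {1}l2E.
rewrite h3; congr (_ *: _); apply: (mulIf vi).
have := Sz_mul v i 0; rewrite h3 mxE => -> //.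
Qed.

End Labels.

(** * Joint eigenvalues counted level by level in S_z *)

Section Counting.
Variables (R : realType) (N : nat).
Local Notation C := R[i].
Variables (e : 'I_#|cfg N| -> 'cV[C]_#|cfg N|) (lam : 'I_#|cfg N| -> R) (kk : 'I_#|cfg N| -> nat).
Hypothesis he : forall a b, adj (e a) *m e b = (a == b)%:R%:M.
Hypothesis kkN : forall a, (kk a <= N)%N.
Hypothesis hj : forall a, jeig (lam a) (spinM R N (kk a)) (e a).

(** A coupling of basis indices that stands in for a decomposition into multiplets: it joins
    adjacent S_z levels at equal S^2, with marginals the eigenvalues of S_+S_- and S_-S_+. *)
Definition ladder (b a : 'I_#|cfg N|) : R := sqn (ip (e b) (Sminus R N *m e a)).

Lemma ladder_col a : \sum_b ladder b a = lam a - spinM R N (kk a) ^+ 2 + spinM R N (kk a).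
Proof.
apply: rC_inj; rewrite rC_sum (parseval_sqn he) -[LHS]ip_conj ip_adj adj_Sminus.
by rewrite (jeig_PM (hj a)) ipZl ip_basis // eqxx mulr1 conjCK.
Qed.

Lemma ladder_row b : \sum_a ladder b a = lam b - spinM R N (kk b) ^+ 2 - spinM R N (kk b).
Proof.
apply: rC_inj; rewrite rC_sum.
transitivity (\sum_a rC (sqn (ip (e a) (Splus R N *m e b)))).
  apply: eq_bigr => a _; rewrite /ladder ip_adj adj_Sminus -ip_conj; congr rC.
  by rewrite conjC_E /sqn /reC /imC /= sqrrN.
rewrite (parseval_sqn he) -[LHS]ip_conj ip_adj adj_Splus.
by rewrite (jeig_MP (hj b)) ipZl ip_basis // eqxx mulr1 conjCK.
Qed.

Lemma spinM_inj k l : spinM R N k = spinM R N l -> k = l.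
Proof. by rewrite /spinM => /addIr /eqP; rewrite eqr_nat => /eqP. Qed.

Lemma ladder_neq0 b a : ladder b a != 0 -> lam b = lam a /\ (kk b).+1 = kk a.
Proof.
move=> h.
have ne : ip (e b) (Sminus R N *m e a) != 0.
  by apply: contra h => /eqP; rewrite /ladder => ->; rewrite sqn0.
have [h2 hz] := jeig_M (hj a); have [g2 gz] := hj b.
split; first exact: (hermitian_orthogonal (adj_S2 R N) g2 h2 ne).
have := hermitian_orthogonal (adj_Sz R N) gz hz ne.
move=> E; apply: spinM_inj; move: E; rewrite /spinM -natr1; lra.
Qed.

(** The S^2 eigenvalue of a multiplet that ends at M or, for M < 0, of one that starts at M + 1;
    these are the ones not shared by levels k and k.+1. *)
Definition ell k : R := spinM R N k * (spinM R N k + 1).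
Definition level_sum k (F : R -> R) : R := \sum_(a | kk a == k) F (lam a).

(** Transport along [ladder]: lam - M^2 + M at level k.+1 and lam - M^2 - M at level k both equal
    lam - [ell k]. *)
Lemma level_sum_ladder k F : level_sum k.+1 (fun l => (l - ell k) * F l) = level_sum k (fun l => (l - ell k) * F l).
Proof.
have H := @sum_transport R _ _ (fun a b => ladder b a) _
  (fun a => if kk a == k.+1 then F (lam a) else 0) _
  (fun b => if kk b == k then F (lam b) else 0) ladder_col ladder_row.
rewrite /level_sum big_mkcond [RHS]big_mkcond /=.
transitivity (\sum_a (lam a - spinM R N (kk a) ^+ 2 + spinM R N (kk a)) * (if kk a == k.+1 then F (lam a) else 0)).
  apply: eq_bigr => a _; case: eqP => [->|_]; last by rewrite mulr0.
  by congr (_ * _); rewrite /ell /spinM -natr1; ring.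
rewrite H => [|a b /ladder_neq0[-> <-]]; last by rewrite eqSS.
apply: eq_bigr => a _; case: eqP => [->|_]; last by rewrite mulr0.
by congr (_ * _); rewrite /ell; ring.
Qed.

Lemma level_sumD k F G : level_sum k (fun l => F l + G l) = level_sum k F + level_sum k G.
Proof. by rewrite /level_sum big_split. Qed.

Lemma level_sum_eq k F G : (forall l, F l = G l) -> level_sum k F = level_sum k G.
Proof. by move=> FG; apply: eq_bigr. Qed.

Lemma level_sumZ k x F : level_sum k (fun l => x * F l) = x * level_sum k F.
Proof. by rewrite /level_sum mulr_sumr. Qed.

Lemma card_ups k : #|[pred s : cfg N | ups s == k]| = 'C(N, k).
Proof.
have h := card_draws 'I_N k; rewrite card_ord in h; rewrite -h.
pose f (s : cfg N) : {set 'I_N} := [set j | s j].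
have fi : injective f.
  by move=> s s' /setP E; apply/ffunP => j; have := E j; rewrite !inE.
rewrite -(card_imset _ fi); apply: eq_card => A; rewrite !inE.
have cA (s : cfg N) : #|f s| = ups s.
  rewrite /ups -sum1_card big_mkcond /=; apply: eq_bigr => j _; rewrite inE; by case: (s j).
apply/imsetP/idP => [[s]|Ak].
  by rewrite inE => sk ->; rewrite cA.
have fA : f [ffun j => j \in A] = A by apply/setP => j; rewrite inE ffunE.
by exists [ffun j => j \in A]; rewrite ?inE -?cA fA.
Qed.

(** The coupling is the squared coordinate of e_a at a configuration; it vanishes unless the
    configuration has exactly [kk a] up spins. *)
Lemma level_sum_count k : level_sum k (fun _ => 1) = 'C(N, k)%:R.
Proof.
have H := @sum_transport R _ _ (fun a i => sqn (e a i 0)) (fun _ => 1)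
  (fun a => if kk a == k then 1 else 0) (fun _ => 1)
  (fun i => if ups (enum_val i) == k then 1 else 0).
rewrite /level_sum big_mkcond /=.
transitivity (\sum_a 1 * (if kk a == k then 1 else 0 : R)); first by apply: eq_bigr => a _; rewrite mul1r.
rewrite H.
- under eq_bigr do rewrite mul1r.
  rewrite (reindex (@enum_rank (cfg N))) /=; last exact/onW_bij/enum_rank_bij.
  under eq_bigr do rewrite enum_rankK.
  by rewrite -big_mkcond /= sumr_const card_ups.
- by move=> a; apply: rC_inj; rewrite -rC_sqn_ip ip_basis // eqxx.
- move=> i; apply: rC_inj; rewrite rC_sum.
  have := basis_resolution he => /matrixP /(_ i i); rewrite summxE mxE eqxx mulr1n => E.
  transitivity (\sum_a (e a *m adj (e a)) i i); last exact: E.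
  by apply: eq_bigr => a _; rewrite mxE big_ord1 !mxE mulrC conj_mul_sqn.
- move=> a i ne.
  have ne' : e a i 0 != 0 by apply: contra ne => /eqP ->; rewrite sqn0.
  have [_ hz] := hj a; have := Sz_mul (e a) i 0; rewrite hz mxE => /(mulIf ne') /rC_inj /spinM_inj ->.
  by [].
Qed.

(* Apply [level_sum_ladder] to [l |-> F l / (l - ell k)], extended by 0 at [ell k]; the
   contribution of [l = ell k] is then fixed by taking [F = 1]. *)
Lemma level_sum_step k F : level_sum k F = level_sum k.+1 F + ('C(N, k)%:R - 'C(N, k.+1)%:R) * F (ell k).
Proof.
pose I l : R := if l == ell k then 1 else 0.
have dec j G : level_sum j G = level_sum j (fun l => (l - ell k) * (if l == ell k then 0 else G l / (l - ell k))) + G (ell k) * level_sum j I.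
  rewrite -level_sumZ -level_sumD; apply: level_sum_eq => l; rewrite /I; case: eqVneq => [->|ne].
    by rewrite mulr0 add0r mulr1.
  by rewrite mulr0 addr0 mulrCA divff ?mulr1 // subr_eq0.
have d G : level_sum k G - level_sum k.+1 G = G (ell k) * (level_sum k I - level_sum k.+1 I).
  by rewrite (dec k G) (dec k.+1 G) level_sum_ladder mulrBr; ring.
have := d (fun _ => 1); rewrite !level_sum_count mul1r => ->.
by rewrite [_ * F _]mulrC -d; ring.
Qed.

Lemma level_sum_top F : level_sum N.+1 F = 0.
Proof. by apply: big1 => a /eqP h; have := kkN a; rewrite h ltnn. Qed.

Lemma level_sum_sum k d F : level_sum k F = level_sum (k + d)%N F +
   \sum_(k <= j < k + d) ('C(N, j)%:R - 'C(N, j.+1)%:R) * F (ell j).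
Proof.
elim: d => [|d IH]; first by rewrite addn0 big_geq ?addr0.
by rewrite IH addnS big_nat_recr ?leq_addr //= level_sum_step; ring.
Qed.

(* [ell] is symmetric and the binomial differences antisymmetric under
   [j |-> N - 1 - j]. *)
Lemma level_sum_sym k F : (2 * k <= N)%N -> level_sum k F = level_sum (N - k)%N F.
Proof.
move=> kN; have h : (k + (N - 2 * k) = N - k)%N by lia.
rewrite (level_sum_sum k (N - 2 * k)) h; set S := \sum_(_ <= _ < _) _.
suff SS : S = - S by rewrite [S](_ : _ = 0) ?addr0 //; lra.
rewrite /S -sumrN big_nat_rev /= big_seq [RHS]big_seq; apply: eq_bigr => j.
rewrite mem_index_iota => /andP[kj jN].
have e1 : (k + (N - k) - j.+1 = N - j.+1)%N by lia.
have e2 : (N - j.+1).+1 = (N - j)%N by lia.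
have e3 : ell (N - j.+1) = ell j.
  rewrite /ell /spinM natrB; last by lia.
  by rewrite -natr1; field.
rewrite e1 e2 e3 !bin_sub; [by ring|lia|lia].
Qed.

Lemma deg_bin i : (2 * i <= N)%N -> 'C(N, N - i)%:R - 'C(N, (N - i).+1)%:R = deg R N i.
Proof.
move=> iN; rewrite bin_sub; last by lia.
have n0 : N.+1%:R != 0 :> R by rewrite pnatr_eq0.
have h1 : N.+1%:R * 'C(N, i)%:R = (N.+1%:R - i%:R) * 'C(N.+1, i)%:R :> R.
  have := mul_bin_down N.+1 i => /(congr1 (fun m : nat => m%:R : R)).
  by rewrite !natrM natrB //=; lia.
have h2 : N.+1%:R * 'C(N, (N - i).+1)%:R = i%:R * 'C(N.+1, i)%:R :> R.
  case: i iN {h1} => [|i] iN; first by rewrite subn0 bin_small // mulr0 mul0r.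
  have -> : (N - i.+1).+1 = (N - i)%N by lia.
  by rewrite bin_sub; [rewrite -!natrM mul_bin_diag|lia].
apply: (mulfI n0); rewrite mulrBr h1 h2 /deg; field.
by move: n0; rewrite -natr1.
Qed.

(** In the upper half one telescopes from the empty level N + 1, each level adding the multiplets of
    that highest weight; the lower half is the mirror image. *)
Lemma level_sum_deg k F : (k <= N)%N ->
  level_sum k F = \sum_(0 <= i < N.+1) (if adm N i k then deg R N i * F (spinJ R N i * (spinJ R N i + 1)) else 0).
Proof.
have up j : (j <= N)%N -> (N <= 2 * j)%N ->
  level_sum j F = \sum_(0 <= i < (N - j).+1) deg R N i * F (spinJ R N i * (spinJ R N i + 1)).
  move=> jN Nj; rewrite (level_sum_sum j (N - j).+1); have -> : (j + (N - j).+1 = N.+1)%N by lia.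
  rewrite level_sum_top add0r -{1}[j]add0n big_addn big_nat_rev /=.
  have -> : (N.+1 - j = (N - j).+1)%N by lia.
  rewrite big_seq [RHS]big_seq; apply: eq_bigr => i; rewrite mem_index_iota => /andP[_ ij].
  have -> : (0 + (N - j).+1 - i.+1 + j = N - i)%N by lia.
  rewrite deg_bin; last by lia.
  congr (_ * F _); rewrite /ell /spinM /spinJ natrB; last by lia.
  by field.
move=> kN; have [Nk|kN2] := leqP N (2 * k).
  rewrite up // -big_mkcond /= (big_nat_widen _ _ N.+1); last by lia.
  by apply: eq_bigl => i; rewrite /adm; lia.
rewrite level_sum_sym; last by lia.
rewrite up; [|lia|lia].
rewrite -big_mkcond /= (big_nat_widen _ _ N.+1); last by lia.
by apply: eq_bigl => i; rewrite /adm; lia.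
Qed.

(** The right side no longer refers to the basis; this is where [lam] becomes J(J+1). *)
Lemma sum_labels (G : R -> nat -> R) : \sum_a G (lam a) (kk a) =
  \sum_(0 <= i < N.+1) \sum_(0 <= k < N.+1)
    (if adm N i k then deg R N i * G (spinJ R N i * (spinJ R N i + 1)) k else 0).
Proof.
rewrite exchange_big /= (partition_big (fun a => inord (kk a) : 'I_N.+1) xpredT) //= big_mkord.
apply: eq_bigr => k _.
transitivity (level_sum k (fun l => G l k)); last by rewrite level_sum_deg // -ltnS.
apply: eq_big => [a|a /eqP <-]; first by rewrite -val_eqE /= inordK // ltnS kkN.
by rewrite inordK // ltnS kkN.
Qed.

End Counting.

(** * The purified expectation *)

Section Tensor.
Variables (R : realType) (I : finType).
Local Notation C := R[i].

Lemma tensE (A B : 'M[C]_#|I|) (u v : 'cV[C]_#|I|) :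
  tens A B *m tensv u v = tensv (A *m u) (B *m v).
Proof.
apply/colP => i; rewrite !mxE.
rewrite (reindex (@enum_rank (pairT I))) /=; last exact/onW_bij/enum_rank_bij.
set p := enum_val i.
transitivity (\sum_(a : I) \sum_(b : I) A (enum_rank p.1) (enum_rank a) * B (enum_rank p.2) (enum_rank b) *
   (u (enum_rank a) 0 * v (enum_rank b) 0)).
  by rewrite pair_big /=; apply: eq_bigr => [[a b]] _; rewrite !mxE enum_rankK.
rewrite (reindex (@enum_rank I)) /=; last exact/onW_bij/enum_rank_bij.
rewrite [in RHS](reindex (@enum_rank I) (P := xpredT) (F := fun j => B _ j * v j 0)) /=;
  last exact/onW_bij/enum_rank_bij.
rewrite mulr_suml; apply: eq_bigr => a _; rewrite mulr_sumr; apply: eq_bigr => b _.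
by rewrite mulrACA.
Qed.

Lemma tensvZl (z : C) (u v : 'cV[C]_#|I|) : tensv (z *: u) v = z *: tensv u v.
Proof. by apply/colP => i; rewrite !mxE mulrA. Qed.

Lemma tensvZr (z : C) (u v : 'cV[C]_#|I|) : tensv u (z *: v) = z *: tensv u v.
Proof. by apply/colP => i; rewrite !mxE mulrCA. Qed.

Lemma ip_tensv (u v u' v' : 'cV[C]_#|I|) : ip (tensv u v) (tensv u' v') = ip u u' * ip v v'.
Proof.
rewrite /ip !mxE.
rewrite (reindex (@enum_rank (pairT I))) /=; last exact/onW_bij/enum_rank_bij.
transitivity (\sum_(a : I) \sum_(b : I) Num.conj (u (enum_rank a) 0) * Num.conj (v (enum_rank b) 0) *
   (u' (enum_rank a) 0 * v' (enum_rank b) 0)).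
  rewrite pair_big /=; apply: eq_bigr => [[a b]] _.
  by rewrite !mxE enum_rankK /= rmorphM.
rewrite (reindex (@enum_rank I)) /=; last exact/onW_bij/enum_rank_bij.
rewrite [in RHS](reindex (@enum_rank I) (P := xpredT) (F := fun j => adj v 0 j * v' j 0)) /=;
  last exact/onW_bij/enum_rank_bij.
rewrite mulr_suml; apply: eq_bigr => a _; rewrite mulr_sumr; apply: eq_bigr => b _.
by rewrite !mxE mulrACA.
Qed.

Lemma tens_pow (A : 'M[C]_#|I|) (z : C) k (u v : 'cV[C]_#|I|) :
  (z *: tens A 1) ^+ k *m tensv u v = z ^+ k *: tensv (A ^+ k *m u) v.
Proof.
elim: k => [|k IH]; first by rewrite !expr0 !mul1mx scale1r.
rewrite !exprS -!mulmxE -mulmxA IH -scalemxAr -scalemxAl tensE scalerA mulrC.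
by rewrite mul1mx mulmxA.
Qed.
End Tensor.

Section Energy.
Variables (R : realType) (N : nat).
Local Notation C := R[i].

Definition energy (eps Tc lam M : R) : R :=
  - (2 * eps) * M - 2 * Tc / N%:R * (lam - M ^+ 2 + M).

Lemma Ham_jeig eps Tc lam M (v : 'cV[C]_#|cfg N|) : jeig lam M v ->
  Ham eps Tc N *m v = rC (energy eps Tc lam M) *: v.
Proof.
move=> j; have [h2 hz] := j.
rewrite /Ham mulmxBl -[(_ *: Sz R N) *m v]scalemxAl -[(_ *: (_ *m _)) *m v]scalemxAl.
rewrite -[(Splus R N *m _) *m v]mulmxA (jeig_PM j) hz !scalerA -scalerBl.
by congr (_ *: _); apply: C_eq; rewrite /energy /rC /reC /imC /=; ring.
Qed.

Lemma jeig_Pn lam M k (v : 'cV[C]_#|cfg N|) : jeig lam M v ->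
  jeig lam (M + k%:R) (Splus R N ^+ k *m v).
Proof.
move=> j; elim: k => [|k IH]; first by rewrite expr0 mul1mx addr0.
by rewrite exprS -mulmxE -mulmxA -natr1 addrA; exact: jeig_P.
Qed.

Lemma jeig_Mn lam M k (v : 'cV[C]_#|cfg N|) : jeig lam M v ->
  jeig lam (M - k%:R) (Sminus R N ^+ k *m v).
Proof.
move=> j; elim: k => [|k IH]; first by rewrite expr0 mul1mx subr0.
by rewrite exprS -mulmxE -mulmxA -natr1 opprD addrA; exact: jeig_M.
Qed.

Lemma jeig_PMn lam M k (v : 'cV[C]_#|cfg N|) : jeig lam M v ->
  Splus R N ^+ k *m (Sminus R N ^+ k *m v) =
  rC (\prod_(j < k) (lam - (M - j%:R) ^+ 2 + (M - j%:R))) *: v.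
Proof.
move=> jv; elim: k => [|k IH]; first by rewrite !expr0 !mul1mx big_ord0 scale1r.
rewrite exprSr exprS -!mulmxE -!mulmxA (jeig_PM (jeig_Mn k jv)) -scalemxAr IH scalerA.
by rewrite big_ord_recr /= -rCM mulrC.
Qed.

Lemma jeig_MPn lam M k (v : 'cV[C]_#|cfg N|) : jeig lam M v ->
  Sminus R N ^+ k *m (Splus R N ^+ k *m v) =
  rC (\prod_(j < k) (lam - (M + j%:R) ^+ 2 - (M + j%:R))) *: v.
Proof.
move=> jv; elim: k => [|k IH]; first by rewrite !expr0 !mul1mx big_ord0 scale1r.
rewrite exprSr exprS -!mulmxE -!mulmxA (jeig_MP (jeig_Pn k jv)) -scalemxAr IH scalerA.
by rewrite big_ord_recr /= -rCM mulrC.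
Qed.

(** [lam] cancels in the energy difference, and M survives only through 4 Tc q M / N. *)
Definition phase_angle (eps Tc mu t q lam M : R) : R :=
  - t * (energy (eps - mu) Tc lam (M + q) - energy (eps - mu) Tc lam M).

Lemma UN_tensv eps mu Tc t q lam M (u v : 'cV[C]_#|cfg N|) : jeig lam (M + q) u -> jeig lam M v ->
  UN eps mu Tc t N *m tensv u v =
  Complex (cos (phase_angle eps Tc mu t q lam M)) (sin (phase_angle eps Tc mu t q lam M)) *: tensv u v.
Proof.
move=> ju jv; rewrite /UN; apply: expm_eigen_imaginary.
rewrite -scalemxAl mulmxBl !tensE !mul1mx (Ham_jeig _ _ ju) (Ham_jeig _ _ jv).
rewrite tensvZl tensvZr -scalerBl scalerA; congr (_ *: _).
by apply: C_eq; rewrite /phase_angle /reC /imC /=; ring.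
Qed.

Lemma rC_ge0 (x : R) : 0 <= x -> 0 <= rC x :> C.
Proof. by move=> x0; have := lecR 0 x; rewrite x0. Qed.

Lemma sqrtC_rC (x : R) : 0 <= x -> sqrtC (rC x : C) = rC (Num.sqrt x).
Proof.
move=> x0; rewrite -[x in LHS]sqr_sqrtr // rCX sqrCK //.
by apply: rC_ge0; exact: sqrtr_ge0.
Qed.
End Energy.

Section Expectation.
Variables (R : realType) (eps Tc beta : R) (N : nat).
Local Notation C := R[i].
Hypothesis Tc_gt0 : 0 < Tc.
Hypothesis N_gt0 : (0 < N)%N.
Variables (e : 'I_#|cfg N| -> 'cV[C]_#|cfg N|) (lam : 'I_#|cfg N| -> R) (kk : 'I_#|cfg N| -> nat).
Hypothesis he : forall a b, adj (e a) *m e b = (a == b)%:R%:M.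
Hypothesis kkN : forall a, (kk a <= N)%N.
Hypothesis hj : forall a, jeig (lam a) (spinM R N (kk a)) (e a).

Let b := 4 * beta * Tc.
Let m0 := eps / (2 * Tc).
Let w a := expR (logw b m0 N (lam a) (spinM R N (kk a))).
Let Z := \sum_a w a.

Lemma gibbs_eigen a :
  expm (rC (- beta) *: Ham eps Tc N) *m e a = rC (w a) *: e a.
Proof.
apply: expm_eigen_real; rewrite -scalemxAl (Ham_jeig _ _ (hj a)) scalerA -rCM.
congr (rC _ *: _); rewrite /energy /logw /b /m0; field.
by rewrite !gt_eqF ?ltr0n.
Qed.

Lemma av_labels (G : R -> nat -> R) : (\sum_a w a * G (lam a) (kk a)) / Z =
  av b m0 N (fun i k => G (spinJ R N i * (spinJ R N i + 1)) k).
Proof.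
have E F : \sum_a w a * F (lam a) (kk a) =
   wsum b m0 N (fun i k => F (spinJ R N i * (spinJ R N i + 1)) k).
  rewrite (sum_labels he kkN hj (fun l k => expR (logw b m0 N l (spinM R N k)) * F l k)).
  apply: eq_bigr => i _; apply: eq_bigr => k _; rewrite /wt; case: ifP => _; last by rewrite mul0r.
  by rewrite mulrA.
rewrite E /av; congr (_ / _); have := E (fun _ _ => 1); rewrite /Z => <-.
by apply: eq_bigr => a _; rewrite mulr1.
Qed.

Lemma Z_gt0 : 0 < Z.
Proof.
have E : Z = wsum b m0 N (fun _ _ => 1).
  rewrite /Z; transitivity (\sum_a expR (logw b m0 N (lam a) (spinM R N (kk a)))); first by [].
  rewrite (sum_labels he kkN hj (fun l k => expR (logw b m0 N l (spinM R N k)))).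
  by apply: eq_bigr => i _; apply: eq_bigr => k _; rewrite mulr1.
by rewrite E wsum1_gt0.
Qed.

Lemma rho_eigen a : rho eps Tc beta N *m e a = rC (w a / Z) *: e a.
Proof.
rewrite /rho; set G := expm _.
have -> : \tr G = rC Z.
  rewrite (trace_basis he) rC_sum; apply: eq_bigr => a' _.
  by rewrite gibbs_eigen ipZr ip_basis // eqxx mulr1.
by rewrite -scalemxAl gibbs_eigen scalerA -rCV -rCM mulrC.
Qed.

Lemma trace_rhoPM : \tr (rho eps Tc beta N *m Splus R N *m Sminus R N) =
  rC (av b m0 N (fun i k => spinJ R N i * (spinJ R N i + 1) - spinM R N k ^+ 2 + spinM R N k)).
Proof.
rewrite -(av_labels (fun l k => l - spinM R N k ^+ 2 + spinM R N k)) (trace_basis he).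
rewrite mulr_suml rC_sum; apply: eq_bigr => a _.
rewrite -!mulmxA (jeig_PM (hj a)) -scalemxAr rho_eigen scalerA ipZr ip_basis // eqxx mulr1.
by rewrite -rCM; congr rC; ring.
Qed.

Lemma rcoefE a : rcoef eps Tc beta e a = rC (w a / Z).
Proof.
rewrite /rcoef -mulmxA rho_eigen -scalemxAr mxE -[(adj _ *m _) 0 0]/(ip (e a) (e a)).
by rewrite ip_basis // eqxx mulr1.
Qed.

Lemma w_ge0 a : 0 <= w a / Z.
Proof. by rewrite divr_ge0 ?(ltW (expR_gt0 _)) // ltW // Z_gt0. Qed.

(** The second tensor factor is untouched, so orthonormality there removes the cross terms and the
    two square roots combine to r_a. *)
Lemma expect_diag (X : 'M[C]_#|pairT (cfg N)|) (u : 'I_#|cfg N| -> 'cV[C]_#|cfg N|) :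
  (forall a, X *m tensv (e a) (e a) = tensv (u a) (e a)) ->
  expect eps Tc beta e X = \sum_a rC (w a / Z) * ip (e a) (u a).
Proof.
move=> hX.
rewrite /expect -mulmxA -[LHS]/(ip (OmegaN eps Tc beta e) (X *m OmegaN eps Tc beta e)).
have -> : X *m OmegaN eps Tc beta e = \sum_a sqrtC (rcoef eps Tc beta e a) *: tensv (u a) (e a).
  by rewrite /OmegaN mulmx_sumr; apply: eq_bigr => a _; rewrite -scalemxAr hX.
have ipDr n (x : 'cV[C]_n) (J : finType) (F : J -> 'cV[C]_n) : ip x (\sum_j F j) = \sum_j ip x (F j).
  by rewrite /ip mulmx_sumr summxE.
have ipDl n (x : 'cV[C]_n) (J : finType) (F : J -> 'cV[C]_n) : ip (\sum_j F j) x = \sum_j ip (F j) x.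
  by rewrite -ip_conj ipDr rmorph_sum /=; apply: eq_bigr => j _; rewrite ip_conj.
rewrite ipDr; apply: eq_bigr => a _; rewrite /OmegaN ipDl (bigD1 a) //= big1 => [|a' ne].
  rewrite addr0 ipZl ipZr ip_tensv ip_basis // eqxx mulr1 mulrA; congr (_ * _).
  rewrite rcoefE sqrtC_rC ?w_ge0 // conjC_E /= oppr0 -/(rC _) -rCM -expr2 sqr_sqrtr ?w_ge0 //.
by rewrite ipZl ipZr ip_tensv ip_basis // (negbTE ne) !mulr0.
Qed.

Variables (mu c t : R) (n n' m m' : nat).
Let q : R := m%:R - m'%:R.

Definition ladder_coef (l M : R) : R :=
  (\prod_(j < m') (l - (M - j%:R) ^+ 2 + (M - j%:R))) *
  \prod_(j < n) (l - (M + j%:R) ^+ 2 - (M + j%:R)).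

Let X := Eminus c N ^+ n *m Eplus c N ^+ n' *m UN eps mu Tc t N
               *m Eplus c N ^+ m *m Eminus c N ^+ m'.
Let theta a := phase_angle N eps Tc mu t q (lam a) (spinM R N (kk a)).
Let s : R := (c * N%:R)^-1 ^+ (n + n' + m + m').

Lemma X_tensv a : X *m tensv (e a) (e a) =
  tensv ((rC s * Complex (cos (theta a)) (sin (theta a))) *:
   (Sminus R N ^+ n *m (Splus R N ^+ n' *m (Splus R N ^+ m *m (Sminus R N ^+ m' *m e a))))) (e a).
Proof.
have ju : jeig (lam a) (spinM R N (kk a) + q) (Splus R N ^+ m *m (Sminus R N ^+ m' *m e a)).
  have := jeig_Pn m (jeig_Mn m' (hj a)); congr jeig; rewrite /q; ring.
rewrite /X -!mulmxA /Eminus /Eplus tens_pow -scalemxAr tens_pow -!scalemxAr.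
rewrite (UN_tensv eps mu Tc t ju (hj a)) -!scalemxAr !tens_pow -!scalemxAr tens_pow.
rewrite !tensvZl !scalerA; congr (_ *: _).
rewrite /s rCX !exprD -/(theta a); move: (Complex _ _) => z; ring.
Qed.

(** The operator string shifts S_z by m + n' - m' - n, and eigenvectors at different S_z are
    orthogonal. *)
Lemma expect_unbalanced : (m + n' != m' + n)%N -> expect eps Tc beta e X = 0.
Proof.
move=> ne; rewrite (expect_diag X_tensv); apply: big1 => a _.
rewrite ipZr; set v := Sminus _ _ ^+ n *m _.
have [->|nz] := eqVneq (ip (e a) v) 0; first by rewrite !mulr0.
have [_ hv] := jeig_Mn n (jeig_Pn n' (jeig_Pn m (jeig_Mn m' (hj a)))).
have [_ hz] := hj a.
have := hermitian_orthogonal (adj_Sz R N) hz hv nz => E.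
have : (m + n')%:R = (m' + n)%:R :> R by rewrite !natrD; lra.
by move/eqP; rewrite eqr_nat (negbTE ne).
Qed.

Lemma expect_balanced : (m + n' = m' + n)%N ->
  reC (expect eps Tc beta e X) = av b m0 N (fun i k =>
    s * ladder_coef (spinJ R N i * (spinJ R N i + 1)) (spinM R N k) *
    cos (phase_angle N eps Tc mu t q (spinJ R N i * (spinJ R N i + 1)) (spinM R N k))) /\
  imC (expect eps Tc beta e X) = av b m0 N (fun i k =>
    s * ladder_coef (spinJ R N i * (spinJ R N i + 1)) (spinM R N k) *
    sin (phase_angle N eps Tc mu t q (spinJ R N i * (spinJ R N i + 1)) (spinM R N k))).
Proof.
move=> bal.
have E : expect eps Tc beta e X =
  \sum_a rC (w a / Z) * (rC (s * ladder_coef (lam a) (spinM R N (kk a))) * Complex (cos (theta a)) (sin (theta a))).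
  rewrite (expect_diag X_tensv); apply: eq_bigr => a _; congr (_ * _); rewrite ipZr.
  (* Balance regroups the n' + m raising operators as n + m', so that each block of lowerings meets
     an equal block of raisings and acts as a scalar. *)
  rewrite [Splus R N ^+ n' *m _]mulmxA mulmxE -exprD addnC bal addnC exprD -mulmxE.
  rewrite -[(Splus R N ^+ n *m _) *m _]mulmxA (jeig_PMn m' (hj a)) -!scalemxAr (jeig_MPn n (hj a)).
  rewrite !ipZr ip_basis // eqxx mulr1 /ladder_coef !rCM; ring.
rewrite -(av_labels (fun l k => s * ladder_coef l (spinM R N k) * cos (phase_angle N eps Tc mu t q l (spinM R N k)))).
rewrite -(av_labels (fun l k => s * ladder_coef l (spinM R N k) * sin (phase_angle N eps Tc mu t q l (spinM R N k)))).
rewrite E reC_sum imC_sum !mulr_suml; split; apply: eq_bigr => a _; rewrite !(reCM, imCM) /rC /reC /imC /= -/(theta a); ring.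
Qed.

End Expectation.

(** * The limiting vacuum expectation *)

Section Vacuum.
Local Open Scope classical_set_scope.
Local Open Scope ring_scope.
Variable R : realType.
Local Notation C := R[i].
Local Notation mu := (@lebesgue_measure R).

Lemma sin_period (x : R) (k : int) : sin (x + k%:~R * (2 * pi)) = sin x.
Proof.
have nat_case (y : R) (j : nat) : sin (y + j%:R * (2 * pi)) = sin y.
  have -> : j%:R * (2 * pi) = (pi *+ 2) *+ j :> R by rewrite -mulr_natr -[pi *+ 2]mulr_natl; ring.
  exact: (periodicn (@sinD2pi R)).
case: k => j; first exact: nat_case.
by have := nat_case (x - j.+1%:R * (2 * pi)) j.+1; rewrite subrK NegzE mulrNz mulNr => ->.
Qed.

Lemma Rintegral_FTC (f F : R -> R) : (forall x : R, is_derive x 1 F (f x)) -> continuous f ->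
  \int[mu]_(x in `[0, 2 * pi]) f x = F (2 * pi) - F 0.
Proof.
move=> dF cf.
have pi2 : (0 : R) < 2 * pi by rewrite mulr_gt0 // pi_gt0.
have cF : continuous F.
  by move=> x; apply: differentiable_continuous; apply/derivable1_diffP; exact: ex_derive.
rewrite /Rintegral (@continuous_FTC2 R f F) //.
- exact: continuous_subspaceT.
- split => [x _||]; first exact: ex_derive.
    exact/cvg_at_right_filter/cF.
  exact/cvg_at_left_filter/cF.
- by move=> x _; rewrite derive1E; apply: derive_val.
Qed.

Lemma is_derive_sin_affine (k p x : R) :
  is_derive x 1 (fun x : R => sin (k * x + p)) (k * cos (k * x + p)).
Proof.
have dl : is_derive x 1 (fun x : R => k * x + p) k.
  by apply: is_derive_eq; rewrite /GRing.scale /=; ring.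
have d := @is_derive1_comp R (@sin R) (fun x : R => k * x + p) x _ _ (is_derive_sin _) dl.
by apply: is_derive_eq; rewrite mulrC.
Qed.

Lemma is_derive_cos_affine (k p x : R) :
  is_derive x 1 (fun x : R => cos (k * x + p)) (k * - sin (k * x + p)).
Proof.
have dl : is_derive x 1 (fun x : R => k * x + p) k.
  by apply: is_derive_eq; rewrite /GRing.scale /=; ring.
have d := @is_derive1_comp R (@cos R) (fun x : R => k * x + p) x _ _ (is_derive_cos _) dl.
by apply: is_derive_eq; rewrite mulrC.
Qed.

Lemma continuous_of_derive (f df : R -> R) : (forall x : R, is_derive x 1 f (df x)) -> continuous f.
Proof.
move=> h x; apply: differentiable_continuous; apply/derivable1_diffP; have := h x.
by move=> [].
Qed.

Lemma Rintegral_scaled_primitive (a : R) (f F df : R -> R) :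
  (forall x : R, is_derive x 1 F (f x)) -> (forall x : R, is_derive x 1 f (df x)) ->
  \int[mu]_(x in `[0, 2 * pi]) (a * f x) = a * (F (2 * pi) - F 0).
Proof.
move=> dF df'.
have dZ (g dg : R -> R) : (forall x : R, is_derive x 1 g (dg x)) ->
    forall x : R, is_derive x 1 (fun x => a * g x) (a * dg x).
  move=> h x; have d := h x; apply: is_derive_eq.
  by rewrite /GRing.scale /= ?mulr0 ?addr0 ?add0r.
rewrite (Rintegral_FTC (dZ _ _ dF) (continuous_of_derive (dZ _ _ df'))).
by rewrite mulrBr.
Qed.

Lemma Rintegral_cos_harmonic (K : int) (a p : R) :
  \int[mu]_(x in `[0, 2 * pi]) (a * cos (K%:~R * x + p)) = if K == 0 then a * (2 * pi) * cos p else 0.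
Proof.
have dc x := is_derive_cos_affine K%:~R p x.
have [K0|K0] := eqVneq K 0.
  have dF (x : R) : is_derive x 1 (fun x : R => cos p * x) (cos (K%:~R * x + p)).
    by apply: is_derive_eq; rewrite K0 mul0r add0r /GRing.scale /=; ring.
  by rewrite (Rintegral_scaled_primitive a dF dc); ring.
have k0 : K%:~R != 0 :> R by rewrite intr_eq0.
have dF (x : R) : is_derive x 1 (fun x : R => K%:~R^-1 * sin (K%:~R * x + p)) (cos (K%:~R * x + p)).
  have d := is_derive_sin_affine K%:~R p x; apply: is_derive_eq.
  by rewrite /GRing.scale /= ?mulr0 ?addr0 ?add0r mulKf.
rewrite (Rintegral_scaled_primitive a dF dc).
by rewrite mulr0 add0r [_ * (2 * pi) + p]addrC sin_period subrr mulr0.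
Qed.

Lemma Rintegral_sin_harmonic (K : int) (a p : R) :
  \int[mu]_(x in `[0, 2 * pi]) (a * sin (K%:~R * x + p)) = if K == 0 then a * (2 * pi) * sin p else 0.
Proof.
rewrite -[p](subrK (pi / 2)); move: (p - pi / 2) => {}p.
rewrite sinDpihalf -(Rintegral_cos_harmonic K a p); congr Rintegral.
by apply/funext => x; rewrite addrA sinDpihalf.
Qed.

(** The integrand is exp(i ((k1 + k2) th - k2 s)) / (2 pi), of which only the zero mode survives. *)
Lemma OmegaL_shift (k1 k2 : int) (s : R) :
  OmegaL (fun f => mulE k1 (transl s (mulE k2 f))) =
  if k1 + k2 == 0 then expi (- (k2%:~R * s)) else 0.
Proof.
pose a : R := (2 * pi)^-1.
have pi2 : (0 : R) < 2 * pi by rewrite mulr_gt0 // pi_gt0.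
have av2 : (Num.sqrt (2 * pi))^-1 * (Num.sqrt (2 * pi))^-1 = a.
  by rewrite -invfM -expr2 sqr_sqrtr // ltW.
have E (th : R) : Num.conj (vac th) * mulE k1 (transl s (mulE k2 (@vac R))) th =
   Complex (a * cos ((k1 + k2)%:~R * th + - (k2%:~R * s))) (a * sin ((k1 + k2)%:~R * th + - (k2%:~R * s))).
  have -> : (k1 + k2)%:~R * th + - (k2%:~R * s) = k1%:~R * th + k2%:~R * (th - s).
    by rewrite intrD; ring.
  rewrite cosD sinD -av2 /mulE /transl /vac /expi /rC.
  by apply: C_eq; rewrite /reC /imC /=; ring.
rewrite /OmegaL /cint02pi; apply: C_eq.
  transitivity (\int[mu]_(x in `[0, 2 * pi]) (a * cos ((k1 + k2)%:~R * x + - (k2%:~R * s)))).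
    by apply: eq_Rintegral => x _; rewrite E.
  rewrite Rintegral_cos_harmonic; case: eqP => _ //.
  by rewrite /reC /expi /= /a mulVf ?mul1r // gt_eqF.
transitivity (\int[mu]_(x in `[0, 2 * pi]) (a * sin ((k1 + k2)%:~R * x + - (k2%:~R * s)))).
  by apply: eq_Rintegral => x _; rewrite E.
rewrite Rintegral_sin_harmonic; case: eqP => _ //.
by rewrite /imC /expi /= /a mulVf ?mul1r // gt_eqF.
Qed.
End Vacuum.

(** * The mesoscopic limit *)

Lemma cong_ext (R : realType) (f f' g : nat -> nat -> nat -> R) :
  (forall N i k, (0 < N)%N -> adm N i k -> f N i k = f' N i k) -> cong f' g -> cong f g.
Proof.
move=> ff [[A hA] bg [D hD]]; split => //.
  by exists A => N i k N0 a; rewrite ff // hA.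
by exists D => N i k N0 a; rewrite ff // hD.
Qed.

(** N = 0 is set aside because the rescaled quantities divide by N. *)
Lemma cvg_eq_pos (R : realType) (u v : nat -> R) (l : R) :
  (forall N, (0 < N)%N -> u N = v N) -> (u @ \oo --> l)%classic -> (v @ \oo --> l)%classic.
Proof.
move=> uv; rewrite -(cvg_shiftS u) -(cvg_shiftS v).
by have -> : (fun n : nat => u n.+1) = (fun n : nat => v n.+1) by apply/funext => n; exact: uv.
Qed.

(** The parameters cover each factor of both products in [ladder_coef] and, at a = 1 and d = 0, the
    eigenvalue of S_+S_- that defines c. *)
Lemma cong_ladder_step (R : realType) (a d : R) :
  cong (fun N i k => (spinJ R N i * (spinJ R N i + 1) - spinM R N k ^+ 2 + a * spinM R N k - d) / (N ^ 2)%:R)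
       (@xsc R).
Proof.
apply: (@cong_ext _ _ (fun N i k => xsc R N i k + (ysc R N i / 2 * (1 / N%:R) +
   (msc R N k * (a / N%:R) - d / N%:R * (1 / N%:R))))).
  move=> N i k N0 _; rewrite /xsc /ysc /msc /spinJ /spinM natrX; field.
  by rewrite pnatr_eq0 -lt0n.
rewrite [X in cong _ X](_ : _ = (fun N i k => xsc R N i k + (ysc R N i / 2 * 0 + (msc R N k * 0 - 0 * 0)))); last first.
  by apply/funext => N; apply/funext => i; apply/funext => k; rewrite !mulr0 subr0 !addr0.
have c0 (x : R) : cong (fun N _ _ => x / N%:R) (fun _ _ _ => 0 : R) by exact: cong_inv.
apply: congD; first exact: cong_refl (bounded_x R).
apply: congD; first by apply: congM => //; apply: congM; [exact: cong_refl (bounded_y R)|exact: cong_cst].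
apply: congD; first by apply: congM => //; exact: cong_refl (bounded_m R).
by apply: congN; apply: congM.
Qed.

Lemma cong_prod (R : realType) (r : nat) (f : nat -> nat -> nat -> nat -> R) g :
  (forall j, cong (f j) g) ->
  cong (fun N i k => \prod_(j < r) f j N i k) (fun N i k => g N i k ^+ r).
Proof.
move=> h; elim: r => [|r IH].
  apply: (@cong_ext _ _ (fun _ _ _ => 1)); first by move=> *; rewrite big_ord0.
  exact: cong_cst.
apply: (@cong_ext _ _ (fun N i k => (\prod_(j < r) f j N i k) * f r N i k)).
  by move=> *; rewrite big_ord_recr.
have -> : (fun N i k => g N i k ^+ r.+1) = (fun N i k => g N i k ^+ r * g N i k).
  by apply/funext => N; apply/funext => i; apply/funext => k; rewrite exprSr.
exact: congM.
Qed.

Lemma labels_of_good_basis (R : realType) eps Tc N (e : 'I_#|cfg N| -> 'cV[R[i]]_#|cfg N|) :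
  good_basis eps Tc e -> exists lam kk,
    (forall a, (kk a <= N)%N) /\ forall a, jeig (lam a) (spinM R N (kk a)) (e a).
Proof.
move=> [he hl].
have H a : exists p : R * nat, (p.2 <= N)%N /\ jeig p.1 (spinM R N p.2) (e a).
  have [l1 [l2 [l3 [_ h2 h3]]]] := hl a.
  by apply: label_exists h2 h3; rewrite ip_basis // eqxx.
have [f hf] := boolp.choice H.
exists (fun a => (f a).1), (fun a => (f a).2).
by split => a; have [] := hf a.
Qed.

Section Limit.
Local Open Scope classical_set_scope.
Local Open Scope ring_scope.
Variables (R : realType) (eps Tc beta mu c t : R) (n n' m m' : nat).
Hypotheses (Tc_gt0 : 0 < Tc) (c_gt0 : 0 < c) (bal : (m + n' = m' + n)%N).
Let b := 4 * beta * Tc.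
Let m0 := eps / (2 * Tc).
Hypothesis hx : negl b m0 (fun N i k => (xsc R N i k - c ^+ 2) ^+ 2).
Hypothesis hm : negl b m0 (fun N i k => (msc R N k - m0) ^+ 2).
Let q : R := m%:R - m'%:R.
Let P := (m' + n)%N.

Lemma cong_ladder_coef :
  cong (fun N i k => (c * N%:R)^-1 ^+ (n + n' + m + m') *
     ladder_coef n m' (spinJ R N i * (spinJ R N i + 1)) (spinM R N k))
   (fun N i k => (c ^+ 2) ^- P * xsc R N i k ^+ P).
Proof.
pose fm (j N i k : nat) : R := (spinJ R N i * (spinJ R N i + 1) - (spinM R N k - j%:R) ^+ 2 + (spinM R N k - j%:R)) / (N ^ 2)%:R.
pose fp (j N i k : nat) : R := (spinJ R N i * (spinJ R N i + 1) - (spinM R N k + j%:R) ^+ 2 - (spinM R N k + j%:R)) / (N ^ 2)%:R.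
have cm j : cong (fm j) (@xsc R).
  refine (cong_ext _ (cong_ladder_step (2 * j%:R + 1) (j%:R ^+ 2 + j%:R))) => N i k _ _.
  by rewrite /fm; congr (_ / _); ring.
have cp j : cong (fp j) (@xsc R).
  refine (cong_ext _ (cong_ladder_step (- (2 * j%:R + 1)) (j%:R ^+ 2 + j%:R))) => N i k _ _.
  by rewrite /fp; congr (_ / _); ring.
apply: (@cong_ext _ _ (fun N i k => (c ^+ 2) ^- P * ((\prod_(j < m') fm j N i k) * \prod_(j < n) fp j N i k))).
  move=> N i k N0 _; rewrite /fm /fp !big_split /= !prodr_const !card_ord /ladder_coef.
  (* Balance makes the number of normalizations even: one (c N)^-2 for each of the P eigenvalue
     factors. *)
  have -> : (n + n' + m + m' = 2 * P)%N by rewrite /P; lia.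
  rewrite mulrACA -exprD -/P exprM exprVn natrX exprMn invfM exprMn -!exprVn; ring.
have -> : (fun N i k => (c ^+ 2) ^- P * xsc R N i k ^+ P) =
   (fun N i k => (c ^+ 2) ^- P * (xsc R N i k ^+ m' * xsc R N i k ^+ n)).
  by apply/funext => N; apply/funext => i; apply/funext => k; rewrite -exprD.
apply: congM; first exact: cong_cst.
by apply: congM; exact: cong_prod.
Qed.

Lemma negl_xsc_pow r : negl b m0 (fun N i k => `|xsc R N i k ^+ r - (c ^+ 2) ^+ r|).
Proof.
elim: r => [|r IH].
  apply: negl_rate => d d0; exists 0 => N N0.
  rewrite (@av_eq _ _ _ _ _ (fun _ _ => 0)); first by rewrite av_cst normr0 mul0r addr0 ltW.
  by move=> i k _; rewrite !expr0 subrr normr0.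
apply: negl_dom (neglD IH (neglZ (`|(c ^+ 2) ^+ r|) (negl_sqrt hx))) => N i k N0 a.
rewrite normr_id.
have /andP[x0 x1] := xsc_bnd R N0 a; have /andP[y0 y1] := ysc_bnd R N0 a.
have -> : xsc R N i k ^+ r.+1 - (c ^+ 2) ^+ r.+1 =
  xsc R N i k * (xsc R N i k ^+ r - (c ^+ 2) ^+ r) + (c ^+ 2) ^+ r * (xsc R N i k - c ^+ 2).
  by rewrite !exprS; ring.
apply: le_trans (ler_normD _ _) _; rewrite !normrM lerD2r ler_piMl //.
by rewrite ger0_norm //; nra.
Qed.

(** The function [phi] stands for cos and sin, giving real and imaginary parts at once. *)
Lemma mesoscopic_limit (phi : R -> R) :
  (forall x y, `|phi x - phi y| <= `|x - y|) -> (forall x, `|phi x| <= 1) ->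
  (fun N => av b m0 N (fun i k => (c * N%:R)^-1 ^+ (n + n' + m + m') *
     ladder_coef n m' (spinJ R N i * (spinJ R N i + 1)) (spinM R N k) *
     phi (phase_angle N eps Tc mu t q (spinJ R N i * (spinJ R N i + 1)) (spinM R N k)))) @ \oo -->
  phi (- t * (2 * mu * q)).
Proof.
move=> lip bnd.
(* The phase without its part 2 Tc (q^2 - q) / N, recentred at m0; since 4 Tc m0 = 2 eps, the
   eps-dependence drops out and 2 mu q remains. *)
pose th x := - t * (2 * mu * q + 4 * Tc * q * (x - m0)).
have cphi : cong (fun N i k => phi (phase_angle N eps Tc mu t q (spinJ R N i * (spinJ R N i + 1)) (spinM R N k)))
   (fun N _ k => phi (th (msc R N k))).
  split; [by exists 1 => *|by exists 1 => *|].
  exists (`|t * (2 * Tc * (q ^+ 2 - q))|) => N i k N0 _; apply: le_trans (lip _ _) _.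
  have n0 : N%:R != 0 :> R by rewrite pnatr_eq0 -lt0n.
  have -> : phase_angle N eps Tc mu t q (spinJ R N i * (spinJ R N i + 1)) (spinM R N k) - th (msc R N k) =
     - (t * (2 * Tc * (q ^+ 2 - q))) / N%:R.
    rewrite /phase_angle /energy /th /m0 /msc /spinM; field.
    by rewrite n0 gt_eqF.
  by rewrite normrM normrN normfV normr_nat.
apply: cong_cvg (cong_sym (congM cong_ladder_coef cphi)) _.
have c2 : (c ^+ 2) ^+ P != 0 by rewrite !expf_neq0 // gt_eqF.
have n1 : negl b m0 (fun N i k => (c ^+ 2) ^- P * xsc R N i k ^+ P * phi (th (msc R N k)) - phi (- t * (2 * mu * q))).
  apply: negl_dom (neglD (neglZ (`|(c ^+ 2) ^- P|) (negl_xsc_pow P))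
     (neglZ (`|t * (4 * Tc * q)|) (negl_sqrt hm))) => N i k N0 a.
  have -> : (c ^+ 2) ^- P * xsc R N i k ^+ P * phi (th (msc R N k)) - phi (- t * (2 * mu * q)) =
     (c ^+ 2) ^- P * (xsc R N i k ^+ P - (c ^+ 2) ^+ P) * phi (th (msc R N k)) +
     (phi (th (msc R N k)) - phi (- t * (2 * mu * q))) by field.
  apply: le_trans (ler_normD _ _) _; apply: lerD.
    by rewrite !normrM ler_piMr // mulr_ge0.
  apply: le_trans (lip _ _) _; rewrite -normrM.
  have -> : th (msc R N k) - - t * (2 * mu * q) = - (t * (4 * Tc * q) * (msc R N k - m0)) by rewrite /th; ring.
  by rewrite normrN.
have -> : (fun N => av b m0 N (fun i k => (c ^+ 2) ^- P * xsc R N i k ^+ P * phi (th (msc R N k)))) =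
  (fun N => av b m0 N (fun i k => (c ^+ 2) ^- P * xsc R N i k ^+ P * phi (th (msc R N k)) - phi (- t * (2 * mu * q)))
     + phi (- t * (2 * mu * q))).
  by apply/funext => N; rewrite [in RHS]avB av_cst subrK.
by have := cvgD n1 (cvg_cst (phi (- t * (2 * mu * q)))); rewrite add0r; apply.
Qed.
End Limit.

Theorem theorem2 (R : realType) (eps Tc beta mu c : R)
  (hTc : 0 < Tc) (hbeta : 0 < beta)
  (hc : cvgC (fun N : nat =>
          sqrtC (\tr (rho eps Tc beta N *m Splus R N *m Sminus R N) / (N ^ 2)%:R))
        (rC c))
  (hcpos : 0 < c)
  (e : forall N : nat, 'I_#|cfg N| -> 'cV[R[i]]_#|cfg N|)
  (he : forall N : nat, good_basis eps Tc (e N))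
  (t : R) (n n' m m' : nat) :
  cvgC (fun N : nat =>
          expect eps Tc beta (e N)
            (Eminus c N ^+ n *m Eplus c N ^+ n' *m UN eps mu Tc t N
               *m Eplus c N ^+ m *m Eminus c N ^+ m'))
       (OmegaL (fun f => mulE (- (n%:Z - n'%:Z))
                          (transl (2 * mu * t) (mulE (m%:Z - m'%:Z) f)))).
Proof.
pose b := 4 * beta * Tc; pose m0 := eps / (2 * Tc).
have b0 : 0 < b by rewrite !mulr_gt0.
pose A N := av b m0 N (fun i k => (spinJ R N i * (spinJ R N i + 1) - spinM R N k ^+ 2 + 1 * spinM R N k - 0) / (N ^ 2)%:R).
have A0 N : (0 < N)%N -> 0 <= A N.
  move=> N0; rewrite /A -[X in X <= _](av_cst b m0 N); apply: av_le => i k /andP[ik ikN].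
  rewrite divr_ge0 //.
  (* This is (J + M)(J - M + 1), nonnegative because |M| <= J. *)
  have -> : spinJ R N i * (spinJ R N i + 1) - spinM R N k ^+ 2 + 1 * spinM R N k - 0 =
     (k%:R - i%:R) * (N%:R - (i + k)%:R + 1) by rewrite natrD /spinJ /spinM; field.
  by apply: mulr_ge0; [|apply: addr_ge0 => //]; rewrite subr_ge0 ler_nat.
have sqrtA N : (0 < N)%N ->
    reC (sqrtC (\tr (rho eps Tc beta N *m Splus R N *m Sminus R N) / (N ^ 2)%:R)) = Num.sqrt (A N).
  move=> N0; have [lam [kk [kkN hj]]] := labels_of_good_basis (he N).
  have [ho _] := he N.
  rewrite (trace_rhoPM eps beta hTc N0 ho kkN hj) -rC_nat -rCV -rCM.
  have -> : av (4 * beta * Tc) (eps / (2 * Tc)) N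
     (fun i k => spinJ R N i * (spinJ R N i + 1) - spinM R N k ^+ 2 + spinM R N k) / (N ^ 2)%:R = A N.
    rewrite /A mulrC -avZ; apply: av_eq => i k _; by rewrite mul1r subr0 mulrC.
  by rewrite sqrtC_rC ?A0.
have cvgA : (A @ \oo --> c ^+ 2)%classic.
  have [h _] := hc; have {}h := cvg_eq_pos sqrtA h.
  have h2 : ((fun N => Num.sqrt (A N) * Num.sqrt (A N)) @ \oo --> c ^+ 2)%classic by exact: (cvgM h h).
  by refine (cvg_eq_pos _ h2) => N N0 /=; rewrite -expr2 sqr_sqrtr ?A0.
have [hx hm] := @concentration R b m0 b0 (c ^+ 2) (exprn_gt0 2 hcpos) (cong_cvg (cong_ladder_step 1 0) cvgA).
rewrite OmegaL_shift.
have [bal|unbal] := eqVneq (m + n')%N (m' + n)%N; last first.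
  rewrite ifF; last by apply/negbTE; apply: contra unbal => /eqP h; apply/eqP; lia.
  have E N : (0 < N)%N -> 0 = expect eps Tc beta (e N) (Eminus c N ^+ n *m Eplus c N ^+ n' *m
      UN eps mu Tc t N *m Eplus c N ^+ m *m Eminus c N ^+ m').
    move=> N0; have [lam [kk [kkN hj]]] := labels_of_good_basis (he N); have [ho _] := he N.
    by rewrite (expect_unbalanced eps beta hTc N0 ho kkN hj mu c t unbal).
  by split; [refine (cvg_eq_pos (u := fun _ => 0) _ _) => [N N0|]; [rewrite -E|exact: cvg_cst]
            |refine (cvg_eq_pos (u := fun _ => 0) _ _) => [N N0|]; [rewrite -E|exact: cvg_cst]].
rewrite ifT; last by apply/eqP; lia.
have qE : (m%:Z - m'%:Z)%:~R = m%:R - m'%:R :> R by rewrite intrB.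
have ang : - ((m%:Z - m'%:Z)%:~R * (2 * mu * t)) = - t * (2 * mu * (m%:R - m'%:R)) :> R.
  by rewrite qE; ring.
split; rewrite /expi ang.
  refine (cvg_eq_pos _ (mesoscopic_limit (mu := mu) (t := t) hTc hcpos bal hx hm (@cos_lip R) (@cos_max R))) => N N0.
  have [lam [kk [kkN hj]]] := labels_of_good_basis (he N); have [ho _] := he N.
  by have [-> _] := expect_balanced eps beta hTc N0 ho kkN hj mu c t bal.
refine (cvg_eq_pos _ (mesoscopic_limit (mu := mu) (t := t) hTc hcpos bal hx hm (@sin_lip R) (@sin_max R))) => N N0.
have [lam [kk [kkN hj]]] := labels_of_good_basis (he N); have [ho _] := he N.
by have [_ ->] := expect_balanced eps beta hTc N0 ho kkN hj mu c t bal.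
Qed.
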